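(* The following problem is coNP-hard: given a CNF formula $F$ and an integer $k$ written in binary, decide whether there exists a regular resolution proof (refutation) of $F$ of size at most $k$.
   Context: A CNF formula is a finite set of clauses. The resolution rule derives from clauses $\gamma \vee x$ and $\delta \vee \neg x$ the resolvent $\gamma \vee \delta$ (resolving on $x$). A resolution proof of $F$ is a directed acyclic graph whose nodes are clauses, whose leaves are clauses of $F$, in which each internal node is the resolvent of its two parents, and whose root is the empty clause. It is regular if no path from the root to a leaf contains two resolution steps on the same variable. The size of a proof is its number of clauses (nodes). *)

(* Defs.v *)
From mathcomp Require Import all_boot.
From mathcomp Require Import finmap.
From Stdlib Require Import BinNums.
Set Implicit Arguments. Unset Strict Implicit. Unset Printing Implicit Defensive.
Local Open Scope fset_scope.

(* Part 1. A computational model: deterministic single-tape Turing     *)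
(* machines over the tape alphabet {0,1,blank} (blank = None).         *)

Inductive move := MLeft | MRight | MStay.

Record TM := {
  tm_Q : finType;
  tm_start : tm_Q;
  tm_halt : tm_Q -> bool;
  tm_delta : tm_Q -> option bool -> tm_Q * option bool * move }.
Arguments tm_start : clear implicits.
Arguments tm_halt : clear implicits.
Arguments tm_delta : clear implicits.

(* configuration: state, cells left of the head (nearest first),
   scanned cell, cells right of the head; both sides blank beyond. *)
Definition config (M : TM) :=
  (tm_Q M * seq (option bool) * option bool * seq (option bool))%type.

Definition tm_step (M : TM) (c : config M) : config M :=
  let: (q, l, a, r) := c in
  if tm_halt M q then c else
  let: (q', b, m) := tm_delta M q a in
  match m with
  | MLeft => match l with
             | [::] => (q', [::], None, b :: r)
             | a' :: l' => (q', l', a', b :: r) end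
  | MRight => match r with
              | [::] => (q', b :: l, None, [::])
              | a' :: r' => (q', b :: l, a', r') end
  | MStay => (q', l, b, r)
  end.

Definition tm_init (M : TM) (x : seq bool) : config M :=
  match x with
  | [::] => (tm_start M, [::], None, [::])
  | b :: x' => (tm_start M, [::], Some b, map Some x')
  end.

Fixpoint take_bits (s : seq (option bool)) : seq bool :=
  match s with
  | Some b :: s' => b :: take_bits s'
  | _ => [::]
  end.

Arguments tm_step : clear implicits.
Definition tm_output (M : TM) (c : config M) : seq bool :=
  let: (_, _, a, r) := c in take_bits (a :: r).

Definition tm_halted (M : TM) (c : config M) : bool :=
  let: (q, _, _, _) := c in tm_halt M q.

Definition poly_time (f : seq bool -> seq bool) : Prop :=
  exists (M : TM) (c : nat), forall x : seq bool,
    exists t : nat, t <= c * (size x) ^ c + c /\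
      tm_halted (iter t (tm_step M) (tm_init M x)) /\
      tm_output (iter t (tm_step M) (tm_init M x)) = f x.

Definition pair_bits (x y : seq bool) : seq bool :=
  flatten [seq [:: b; b] | b <- x] ++ [:: false; true] ++ y.

Definition language := seq bool -> Prop.

Definition NP (L : language) : Prop :=
  exists V : seq bool -> seq bool, poly_time V /\
  exists c : nat, forall x : seq bool,
    L x <-> exists y : seq bool,
      size y <= c * (size x) ^ c + c /\ V (pair_bits x y) = [:: true].

Definition coNP (L : language) : Prop := NP (fun x => ~ L x).

Definition poly_reduces (L L' : language) : Prop :=
  exists f : seq bool -> seq bool, poly_time f /\ forall x, L x <-> L' (f x).

Definition coNP_hard (L' : language) : Prop :=
  forall L : language, coNP L -> poly_reduces L L'.

(* a literal (v, true) is x_v, (v, false) is the negation of x_v *)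
Definition lit := (nat * bool)%type.
Definition clause := {fset lit}.
Definition formula_of (cs : seq (seq lit)) : pred clause :=
  fun C => C \in [seq [fset l in c] | c <- cs].

Definition resolvent (C1 C2 : clause) (v : nat) : clause :=
  (C1 `\ (v, true)) `|` (C2 `\ (v, false)).

(* A resolution DAG with nodes 'I_size.  A node is a leaf (None) or an
   internal node Some (a, b, v): the resolvent of its parents a and b on
   variable v.  Parents have smaller index (so the graph is acyclic). *)
Record res_dag := {
  rd_size : nat;
  rd_lab : 'I_rd_size -> clause;
  rd_kind : 'I_rd_size -> option ('I_rd_size * 'I_rd_size * nat);
  rd_root : 'I_rd_size }.
Arguments rd_lab : clear implicits.
Arguments rd_kind : clear implicits.

(* child_to_parent P v u : u is a parent of v (edge traversed from the
   root towards the leaves) *)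
Definition child_to_parent (P : res_dag) (v u : 'I_(rd_size P)) : bool :=
  match rd_kind P v with
  | Some (a, b, _) => (u == a) || (u == b)
  | None => false
  end.

Definition pivot (P : res_dag) (v : 'I_(rd_size P)) : option nat :=
  match rd_kind P v with
  | Some (_, _, x) => Some x
  | None => None
  end.

Arguments child_to_parent : clear implicits.
Arguments pivot : clear implicits.
Definition is_resolution_proof (F : pred clause) (P : res_dag) : Prop :=
  (* the nodes are clauses: distinct nodes carry distinct clauses *)
  injective (rd_lab P) /\
  (forall i : 'I_(rd_size P),
     match rd_kind P i with
     | None => F (rd_lab P i)
     | Some (a, b, v) =>
         [/\ a < i, b < i, (v, true) \in rd_lab P a,
             (v, false) \in rd_lab P b &
             rd_lab P i = resolvent (rd_lab P a) (rd_lab P b) v]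
     end) /\
  rd_lab P (rd_root P) = fset0 /\
  (* the root is the unique sink *)
  (forall u, u != rd_root P -> exists v, child_to_parent P v u).

Definition regular (P : res_dag) : Prop :=
  forall p : seq 'I_(rd_size P),
    path (child_to_parent P) (rd_root P) p ->
    rd_kind P (last (rd_root P) p) = None ->
    uniq (pmap (pivot P) (rd_root P :: p)).

Inductive sym := S0 | S1 | SComma | SSemi.

Definition sym_bits (s : sym) : seq bool :=
  match s with
  | S0 => [:: false; false] | S1 => [:: false; true]
  | SComma => [:: true; false] | SSemi => [:: true; true] end.

Fixpoint pos_digits (p : positive) : seq sym :=
  match p with
  | xI p' => S1 :: pos_digits p'
  | xO p' => S0 :: pos_digits p'
  | xH => [:: S1]
  end.

(* binary (little-endian) notation of a natural number *)
Definition bin_digits (n : nat) : seq sym :=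
  match bin_of_nat n with N0 => [::] | Npos p => pos_digits p end.

Definition lit_syms (l : lit) : seq sym :=
  (if l.2 then S1 else S0) :: bin_digits l.1 ++ [:: SComma].

Definition clause_syms (c : seq lit) : seq sym :=
  flatten (map lit_syms c) ++ [:: SSemi].

Definition encode_instance (cs : seq (seq lit)) (k : nat) : seq bool :=
  flatten (map sym_bits (bin_digits k ++ [:: SSemi] ++
                         flatten (map clause_syms cs))).

Definition REGRES_SIZE : language :=
  fun x => exists (cs : seq (seq lit)) (k : nat),
    x = encode_instance cs k /\
    exists P : res_dag,
      is_resolution_proof (formula_of cs) P /\ regular P /\ rd_size P <= k.

(* Main.v *)
(* A CNF formula with N literal occurrences either is satisfiable, and then by
   soundness has no refutation at all, or has a regular refutation of size at
   most 2^N: resolving on the variables in a fixed order, as in a decision tree,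
   only yields clauses over the given literals, and pivots increase along every
   path.  As the size bound is written in binary, unsatisfiability of F is thus
   the instance (F, 2^N).

   It remains to reduce the complement of an NP language to unsatisfiability in
   polynomial time on a single-tape machine.  The tableau of the verifier is
   taken relative to the head: at each time there are a state and scanned
   letter, and the cells to the left and to the right of the head.  Up to the
   input row all its clauses are uniform in the time t and the position i, so
   the reduction is computed by nested loops over the positions of a word whose
   length exceeds the running time; variables are named by the unary values of
   t and i.  Such loop programs run on one tape by marking loop positions. *)
Require Import Defs.
From mathcomp Require Import all_boot.
From mathcomp Require Import finmap.
From mathcomp Require Import zify.
From Stdlib Require Import BinNums FunctionalExtensionality Classical ClassicalEpsilon.
Set Implicit Arguments. Unset Strict Implicit. Unset Printing Implicit Defensive.

(** * Structured tape programs *)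

(** Head-relative coordinates keep every clause within reach of two loop counters. A head move
    shifts both half tapes by one cell, so cells are copied between indices that differ by at most
    one, and no clause names a head position. The price is that the ends of a row get no clause: one
    column is lost per step, which is why the word must outlast the run.

    The transition clauses are implications from facts at time [t] to facts at time [t + 1]. The
    facts of the actual run are thereby forced, and it suffices to forbid halting without
    acceptance; that the run halts inside the tableau follows from the time bound of the verifier,
    valid on every input.

    The bound [2 ^ e] is printed as [e] zeros and a one, so two nested loops with a constant body
    print it once [e] is a constant times the square of the word length.

    In a refutation, distinct nodes carry distinct clauses and every node but the root is used.
    Hence one last rule is chosen for each derivable clause, and the clauses reachable from the
    empty one by these rules become the nodes. *)

Notation cell := (option bool).
Notation stream := (nat -> cell).

Ltac case_ifs := repeat (case: ifP => ?; first [exfalso; lia | idtac]).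

Definition scons (a : cell) (s : stream) : stream :=
  fun n => if n is n'.+1 then s n' else a.

Definition stail (s : stream) : stream := fun n => s n.+1.

Notation tape := (stream * cell * stream)%type.

Definition scanned (T : tape) : cell := T.1.2.

Definition tact (b : cell) (m : move) (T : tape) : tape :=
  let: (l, _, r) := T in
  match m with
  | MLeft => (stail l, l 0, scons b r)
  | MRight => (scons b l, r 0, stail r)
  | MStay => (l, b, r)
  end.

Definition sstep (M : TM) (c : tm_Q M * tape) : tm_Q M * tape :=
  let: (q, T) := c in
  if tm_halt M q then c else
  let: (q', b, m) := tm_delta M q (scanned T) in (q', tact b m T).

Arguments sstep : clear implicits.

(** Half tapes become functions because lists that differ in trailing blanks describe the same tape;
    as functions they are equal. *)
Definition sconf (M : TM) (c : config M) : tm_Q M * tape :=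
  let: (q, l, a, r) := c in (q, (nth None l, a, nth None r)).

Lemma scons_nth a l : scons a (nth None l) = nth None (a :: l).
Proof. by apply: functional_extensionality; case. Qed.

Lemma stail_nth a l : stail (nth None (a :: l)) = nth None l.
Proof. by apply: functional_extensionality; case. Qed.

Lemma stail_nil : stail (nth None [::]) = nth None [::].
Proof. by apply: functional_extensionality; case. Qed.

Lemma sconf_step M c : sconf (tm_step M c) = sstep M (sconf c).
Proof.
case: c => [[[q l] a] r] /=; case: (tm_halt M q) => //=; rewrite /scanned /=.
case: (tm_delta M q a) => [[q' b] []] /=.
- by case: l => [|a' l] /=; rewrite scons_nth ?stail_nil ?stail_nth.
- by case: r => [|a' r] /=; rewrite scons_nth ?stail_nil ?stail_nth.
- by [].
Qed.

Lemma sconf_iter M n c :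
  sconf (iter n (tm_step M) c) = iter n (sstep M) (sconf c).
Proof. by elim: n => //= n <-; rewrite sconf_step. Qed.

Lemma sstep_halted M n q T :
  tm_halt M q -> iter n (sstep M) (q, T) = (q, T).
Proof. by move=> h; elim: n => //= n ->; rewrite /= h. Qed.

Inductive prog :=
| PAct of (cell -> cell) & move
| PSeq of prog & prog
| PIf of (cell -> bool) & prog & prog
| PWhile of (cell -> bool) & prog.

(* n counts the steps of the machine [compile p] *)
Inductive exec : prog -> tape -> nat -> tape -> Prop :=
| EAct f m T : exec (PAct f m) T 1 (tact (f (scanned T)) m T)
| ESeq p q T1 T2 T3 n1 n2 :
    exec p T1 n1 T2 -> exec q T2 n2 T3 -> exec (PSeq p q) T1 (n1 + n2).+1 T3
| EIfT (b : cell -> bool) p q T T' n : b (scanned T) -> exec p T n T' -> exec (PIf b p q) T n.+1 T'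
| EIfF (b : cell -> bool) p q T T' n :
    ~~ b (scanned T) -> exec q T n T' -> exec (PIf b p q) T n.+1 T'
| EWhileF (b : cell -> bool) p T : ~~ b (scanned T) -> exec (PWhile b p) T 1 T
| EWhileT (b : cell -> bool) p T T' T'' n n' :
    b (scanned T) -> exec p T n T' -> exec (PWhile b p) T' n' T'' ->
    exec (PWhile b p) T (n + n').+2 T''.

Definition act_tm (f : cell -> cell) (m : move) : TM :=
  {| tm_Q := bool; tm_start := false; tm_halt := id;
     tm_delta := fun _ a => (true, f a, m) |}.

Definition seq_tm (M N : TM) : TM :=
  {| tm_Q := (tm_Q M + tm_Q N)%type;
     tm_start := inl (tm_start M);
     tm_halt := fun q => if q is inr q' then tm_halt N q' else false;
     tm_delta := fun q a => match q with
       | inl q1 => if tm_halt M q1 then (inr (tm_start N), a, MStay) else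
                   let: (q', b, m) := tm_delta M q1 a in (inl q', b, m)
       | inr q2 => let: (q', b, m) := tm_delta N q2 a in (inr q', b, m)
       end |}.

Definition if_tm (t : cell -> bool) (M N : TM) : TM :=
  {| tm_Q := option (tm_Q M + tm_Q N)%type;
     tm_start := None;
     tm_halt := fun q => match q with
       | Some (inl q1) => tm_halt M q1
       | Some (inr q2) => tm_halt N q2
       | None => false end;
     tm_delta := fun q a => match q with
       | Some (inl q1) =>
           let: (q', b, m) := tm_delta M q1 a in (Some (inl q'), b, m)
       | Some (inr q2) =>
           let: (q', b, m) := tm_delta N q2 a in (Some (inr q'), b, m)
       | None => (Some (if t a then inl (tm_start M) else inr (tm_start N)),
                  a, MStay)
       end |}.

Definition while_tm (t : cell -> bool) (M : TM) : TM :=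
  {| tm_Q := option (option (tm_Q M));
     tm_start := None;
     tm_halt := fun q => if q is Some None then true else false;
     tm_delta := fun q a => match q with
       | Some (Some q1) => if tm_halt M q1 then (None, a, MStay) else
           let: (q', b, m) := tm_delta M q1 a in (Some (Some q'), b, m)
       | Some None => (Some None, a, MStay)
       | None => (Some (if t a then Some (tm_start M) else None), a, MStay)
       end |}.

Fixpoint compile (p : prog) : TM :=
  match p with
  | PAct f m => act_tm f m
  | PSeq p q => seq_tm (compile p) (compile q)
  | PIf t p q => if_tm t (compile p) (compile q)
  | PWhile t p => while_tm t (compile p)
  end.

Definition halts_in (M : TM) (q : tm_Q M) (T : tape) (n : nat) (T' : tape) :=
  exists q', tm_halt M q' /\ iter n (sstep M) (q, T) = (q', T').

Lemma tact_stay T : tact (scanned T) MStay T = T.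
Proof. by case: T => [[l a] r]. Qed.

(** A halted machine idles, so [n] only bounds the running time of [M]; the hand-over to [N] takes
    one step after [M] first halts, at some [k <= n]. *)
Lemma seq_tm_left M N q T n T' :
  halts_in q T n T' ->
  exists2 k, k <= n & iter k.+1 (sstep (seq_tm M N)) (inl q, T)
                      = (inr (tm_start N), T').
Proof.
elim: n q T => [|n IH] q T [q' [hq']].
  by move=> /= [? ?]; subst; exists 0 => //=; rewrite hq' tact_stay.
rewrite iterSr /=; case: ifP => hq.
  rewrite sstep_halted // => -[? ?]; subst.
  by exists 0 => //=; rewrite hq tact_stay.
case E: (tm_delta M q (scanned T)) => [[q1 b] m] Hit.
have [k le_k Hk] := IH q1 (tact b m T) (ex_intro _ q' (conj hq' Hit)).
by exists k.+1 => //; rewrite iterSr /= hq E.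
Qed.

(** Once control has entered a component of a composite machine, it stays there and acts as that
    component alone. *)
Lemma embed_halts M N (h : tm_Q M -> tm_Q N) q T n T' :
  (forall q, tm_halt N (h q) = tm_halt M q) ->
  (forall q a, ~~ tm_halt M q -> tm_delta N (h q) a =
     let: (q', b, m) := tm_delta M q a in (h q', b, m)) ->
  halts_in q T n T' -> halts_in (h q) T n T'.
Proof.
move=> hh hd [q' [hq' Hit]]; exists (h q'); split; first by rewrite hh.
elim: n q T Hit => [|n IH] q T; first by move=> /= [-> ->].
rewrite !iterSr /= hh; case: ifP => hq; first by exact: IH.
by rewrite hd ?hq //; case: (tm_delta M q _) => [[q1 b] m]; exact: IH.
Qed.

Lemma while_tm_body t M q T n T' :
  halts_in q T n T' ->
  exists2 k, k <= n & iter k.+1 (sstep (while_tm t M)) (Some (Some q), T)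
                      = (None, T').
Proof.
elim: n q T => [|n IH] q T [q' [hq']].
  by move=> /= [? ?]; subst; exists 0 => //=; rewrite hq' tact_stay.
rewrite iterSr /=; case: ifP => hq.
  rewrite sstep_halted // => -[? ?]; subst.
  by exists 0 => //=; rewrite hq tact_stay.
case E: (tm_delta M q (scanned T)) => [[q1 b] m] Hit.
have [k le_k Hk] := IH q1 (tact b m T) (ex_intro _ q' (conj hq' Hit)).
by exists k.+1 => //; rewrite iterSr /= hq E.
Qed.

Lemma halts_in_prefix M q T k q1 T1 n T' N :
  iter k (sstep M) (q, T) = (q1, T1) -> halts_in q1 T1 n T' -> k + n <= N ->
  halts_in q T N T'.
Proof.
move=> Hk [q' [hq' Hn]] le_N; exists q'; split=> //.
rewrite -(subnK le_N) iterD (addnC k n) iterD Hk Hn.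
by rewrite sstep_halted.
Qed.

Lemma compile_correct p T n T' :
  exec p T n T' -> halts_in (tm_start (compile p)) T n T'.
Proof.
elim=> {p T n T'}.
- by move=> f m T; exists true.
- move=> p q T1 T2 T3 n1 n2 _ IH1 _ IH2 /=.
  have [k le_k Hk] := @seq_tm_left _ (compile q) _ _ _ _ IH1.
  apply: (halts_in_prefix Hk (n := n2)); last by lia.
  exact: (@embed_halts _ (seq_tm (compile p) (compile q)) inr).
- move=> t p q T T' n ht _ IH /=.
  apply: (@halts_in_prefix (if_tm t (compile p) (compile q)) _ _ 1 (Some (inl (tm_start (compile p)))) T n) => //=.
    by rewrite tact_stay ht.
  exact: (@embed_halts _ (if_tm t (compile p) (compile q)) (Some \o inl)).
- move=> t p q T T' n ht _ IH /=.
  apply: (@halts_in_prefix (if_tm t (compile p) (compile q)) _ _ 1 (Some (inr (tm_start (compile q)))) T n) => //=.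
    by rewrite tact_stay (negbTE ht).
  exact: (@embed_halts _ (if_tm t (compile p) (compile q)) (Some \o inr)).
- move=> t p T ht; exists (Some None); split=> //=.
  by rewrite tact_stay (negbTE ht).
- move=> t p T T' T'' n n' ht _ IH _ IH'.
  have [k le_k Hk] := @while_tm_body t _ _ _ _ _ IH.
  apply: (@halts_in_prefix (while_tm t (compile p)) _ _ 1 (Some (Some (tm_start (compile p)))) T (n + n').+1).
  + by rewrite /= tact_stay ht.
  + by apply: (halts_in_prefix Hk IH'); lia.
  + by lia.
Qed.

Definition runs (p : prog) (T : tape) (N : nat) (T' : tape) : Prop :=
  exists2 n, n <= N & exec p T n T'.

Definition bits_tape (x : seq bool) : tape :=
  (fun _ => None, head None (map Some x), nth None (behead (map Some x))).

(** The tape fixes the list of cells only up to trailing blanks; reading stops at the first blank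
    and so cannot tell the difference. *)
Lemma take_bits_nth (s : seq cell) (o : seq bool) :
  (forall i, nth None s i = nth None (map Some o) i) -> take_bits s = o.
Proof.
elim: s o => [|a s IH] [|b o] H //=.
- by have := H 0.
- by have /= := H 0; case: a {H}.
- have /= := H 0; move=> ->; congr (_ :: _); apply: IH => i.
  exact: (H i.+1).
Qed.

Lemma leq_exp_base e m n : m <= n -> m ^ e <= n ^ e.
Proof. by case: e => // e le_mn; rewrite leq_exp2r. Qed.

(** Bounds are kept in the form [(n + 2) ^ a]: as the base is at least 2, constants, sums and
    products are absorbed into the exponent. Here, for [n <= 1], the additive constant covers
    everything; otherwise [n + 2 <= 4 * n]. *)
Lemma expn2_poly a n : (n + 2) ^ a <= (4 ^ a + a) * n ^ (4 ^ a + a) + (4 ^ a + a).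
Proof.
have [n1|n1] := leqP n 1.
  apply: leq_trans (leq_addl _ _); apply: leq_trans (leq_addr _ _).
  by apply: leq_exp_base; lia.
apply: leq_trans (leq_addr _ _).
apply: (@leq_trans (4 ^ a * n ^ a)).
  by rewrite -expnMn; apply: leq_exp_base; lia.
apply: leq_mul; first exact: leq_addr.
by apply: leq_pexp2l; [lia | exact: leq_addl].
Qed.

Lemma prog_poly_time p (g : seq bool -> seq bool) a :
  (forall x, runs p (bits_tape x) ((size x + 2) ^ a) (bits_tape (g x))) ->
  poly_time g.
Proof.
move=> H; exists (compile p), (4 ^ a + a) => x.
have [n le_n Hn] := H x; exists n; split.
  exact: leq_trans le_n (expn2_poly a (size x)).
have [q [hq Hit]] := compile_correct Hn.
have E : sconf (tm_init (compile p) x) = (tm_start (compile p), bits_tape x).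
  by case: x {H le_n Hn Hit} => [|b x] //=; rewrite /bits_tape /=;
    congr (_, (_, _, _)); apply: functional_extensionality; case.
have := sconf_iter n (tm_init (compile p) x); rewrite E Hit.
case: (iter n _ _) => [[[q1 l] c] r] /= [-> _ -> Hr]; split=> //.
apply: (@take_bits_nth (head None (map Some (g x)) :: r)) => i.
case: i => [|i] /=; first by case: (g x).
by rewrite Hr; case: (g x) => //=; case: i.
Qed.

(* contents f on [0, oo), blank on the left of cell 0, head on cell k *)
Definition tape_at (f : nat -> cell) (k : nat) : tape :=
  (fun n => if n < k then f (k - n.+1) else None, f k, fun n => f (k + n.+1)).

Definition upd (f : nat -> cell) (k : nat) (b : cell) : nat -> cell :=
  fun n => if n == k then b else f n.

Definition skip := PAct id MStay.
Definition mvR := PAct id MRight.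
Definition mvL := PAct id MLeft.
Definition wr (b : cell) := PAct (fun=> b) MStay.

Fixpoint rep (k : nat) (p : prog) : prog :=
  if k is k'.+1 then PSeq p (rep k' p) else skip.

Definition is1 (c : cell) : bool := c == Some true.
Definition goR := PWhile isSome mvR.
(** Unlike [goR], it moves before testing, since it may start on the blank that ended the previous
    walk. *)
Definition goL := PSeq mvL (PWhile isSome mvL).

Lemma runsW p T N N' T' : runs p T N T' -> N <= N' -> runs p T N' T'.
Proof. by case=> n le_n Hn le_N; exists n => //; apply: leq_trans le_N. Qed.

Lemma runs_seq p q T1 T2 T3 N1 N2 N :
  runs p T1 N1 T2 -> runs q T2 N2 T3 -> N1 + N2 < N -> runs (PSeq p q) T1 N T3.
Proof.
move=> [n1 le1 H1] [n2 le2 H2] le_N; exists (n1 + n2).+1; first by lia.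
exact: ESeq H1 H2.
Qed.

Lemma runs_if (t : cell -> bool) p q (T T' : tape) N :
  runs (if t (scanned T) then p else q) T N T' -> runs (PIf t p q) T N.+1 T'.
Proof.
case: ifP => ht [n le_n Hn]; exists n.+1 => //; first exact: EIfT.
by apply: EIfF => //; rewrite ht.
Qed.

(** The loop invariant is the family [S] of tapes between rounds; each round pays two extra steps,
    for the test and for the return to it. *)
Lemma runs_while (t : cell -> bool) p (S : nat -> tape) n C :
  (forall i, i < n -> t (scanned (S i)) /\ runs p (S i) C (S i.+1)) ->
  ~~ t (scanned (S n)) -> runs (PWhile t p) (S 0) (n * (C + 2) + 1) (S n).
Proof.
elim: n S => [|n IH] S H Hn; first by exists 1 => //; apply: EWhileF.
have [h0 [n0 le0 H0]] := H 0 isT.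
have [k lek Hk] := IH (fun i => S i.+1) (fun i hi => H i.+1 hi) Hn.
exists (n0 + k).+2; first by lia.
exact: EWhileT H0 Hk.
Qed.

Lemma tape_at_right f k : tact (f k) MRight (tape_at f k) = tape_at f k.+1.
Proof.
rewrite /tape_at /=; congr (_, _, _); last 2 first.
- by rewrite addn1.
- by apply: functional_extensionality => n; rewrite /stail addnS addSn.
apply: functional_extensionality => -[|n] /=; first by rewrite subSS subn0.
by rewrite ltnS subSS.
Qed.

Lemma tape_at_left f k : tact (f k.+1) MLeft (tape_at f k.+1) = tape_at f k.
Proof.
rewrite /tape_at /=; congr (_, _, _); last 2 first.
- by rewrite subSS subn0.
- by apply: functional_extensionality => -[|n] /=; rewrite ?addn1 ?addnS ?addSn.
Qed.

Lemma tape_at_write f k b : tact b MStay (tape_at f k) = tape_at (upd f k b) k.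
Proof.
rewrite /tape_at /upd /= eqxx; congr (_, _, _); apply: functional_extensionality => n.
  by case: ltnP => // lt_nk; rewrite ifN //; lia.
by rewrite ifN //; lia.
Qed.

Lemma run_mvR f k : runs mvR (tape_at f k) 1 (tape_at f k.+1).
Proof.
exists 1 => //; rewrite -(tape_at_right f k).
by have := EAct id MRight (tape_at f k).
Qed.

Lemma run_mvL f k : runs mvL (tape_at f k.+1) 1 (tape_at f k).
Proof.
exists 1 => //; rewrite -(tape_at_left f k).
by have := EAct id MLeft (tape_at f k.+1).
Qed.

Lemma run_wr f k b : runs (wr b) (tape_at f k) 1 (tape_at (upd f k b) k).
Proof.
exists 1 => //; rewrite -tape_at_write.
by have := EAct (fun=> b) MStay (tape_at f k).
Qed.

Lemma run_repR f k j : runs (rep j mvR) (tape_at f k) (j * 2 + 1) (tape_at f (k + j)).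
Proof.
elim: j k => [|j IH] k /=.
  by exists 1 => //; rewrite addn0; have := EAct id MStay (tape_at f k).
apply: runs_seq (run_mvR f k) _ _; first by rewrite addnS -addSn; apply: IH.
by lia.
Qed.

Lemma run_repL f k j :
  j <= k -> runs (rep j mvL) (tape_at f k) (j * 2 + 1) (tape_at f (k - j)).
Proof.
elim: j k => [|j IH] k /=.
  by exists 1 => //; rewrite subn0; have := EAct id MStay (tape_at f k).
case: k => // k le_jk; apply: runs_seq (run_mvL f k) _ _; last first.
- exact: leqnn.
- by rewrite subSS; apply: runsW (IH k _) _ => //; lia.
Qed.

Lemma run_goR (f : stream) k j :
  k <= j -> (forall n, k <= n < j -> f n) -> f j = None ->
  runs goR (tape_at f k) ((j - k) * 3 + 1) (tape_at f j).
Proof.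
move=> le_kj H Hj.
have := @runs_while isSome mvR (fun i => tape_at f (k + i)) (j - k) 1.
rewrite addn0 subnKC //; apply.
  move=> i hi; split; first by rewrite /scanned /=; apply: H; lia.
  by rewrite addnS; apply: run_mvR.
by rewrite /scanned /= Hj.
Qed.

Lemma run_goL (f : stream) k j :
  j < k -> (forall n, j < n < k -> f n) -> f j = None ->
  runs goL (tape_at f k) ((k - j) * 3 + 1) (tape_at f j).
Proof.
case: k => // k le_jk H Hj.
have := @runs_while isSome mvL (fun i => tape_at f (k - i)) (k - j) 1.
rewrite subn0 subKn //= => K.
apply: runs_seq (run_mvL f k) (K _ _) _; last by lia.
  move=> i hi; split; first by rewrite /scanned /=; apply: H; lia.
  by rewrite (_ : k - i = (k - i.+1).+1); [apply: run_mvL | lia].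
by rewrite /scanned /= Hj.
Qed.

Lemma run_skip1 f k w n :
  (forall i, i < n -> f (k + w * i) = Some true) -> f (k + w * n) = Some false ->
  runs (PWhile is1 (rep w mvR)) (tape_at f k) (n * (w * 2 + 3) + 1)
       (tape_at f (k + w * n)).
Proof.
move=> H Hn.
have := @runs_while is1 (rep w mvR) (fun i => tape_at f (k + w * i)) n (w * 2 + 1).
rewrite muln0 addn0 => K; apply: runsW (K _ _) _.
- move=> i hi; split; first by rewrite /scanned /= H.
  by rewrite (_ : k + w * i.+1 = k + w * i + w); [apply: run_repR | rewrite mulnS; lia].
- by rewrite /scanned /= Hn.
- by rewrite leq_add2r leq_mul2l; apply/orP; right; lia.
Qed.

(* Layout of the working tape: cell 8 is blank ("home"); then come the letters
   of s as blocks of 8 bits, a blank, and the output.  In the block of letter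
   number j, bit v < 3 tells whether j < env v, where env v is the current
   value of loop variable v; the other bits code the letter in unary. *)
Definition bit_at (s : seq nat) (env : nat -> nat) (j b : nat) : bool :=
  if b < 3 then j < env b else b == 3 + nth 0 s j.

Definition layout (s : seq nat) env (out : seq bool) (n : nat) : cell :=
  if n <= 8 then None else
  if n < 9 + 8 * size s then Some (bit_at s env ((n - 9) %/ 8) ((n - 9) %% 8))
  else if n == 9 + 8 * size s then None
  else nth None (map Some out) (n - (10 + 8 * size s)).

Definition home s env out := tape_at (layout s env out) 8.

Definition set_env (env : nat -> nat) (v i : nat) : nat -> nat :=
  fun u => if u == v then i else env u.

Lemma layout_lo s env out n : n <= 8 -> layout s env out n = None.
Proof. by rewrite /layout => ->. Qed.

Lemma layout_block s env out j b :
  j < size s -> b < 8 -> layout s env out (9 + 8 * j + b) = Some (bit_at s env j b).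
Proof.
move=> hj hb; rewrite /layout; case_ifs.
have -> : 9 + 8 * j + b - 9 = j * 8 + b by lia.
by rewrite divnMDl // modnMDl divn_small // addn0 modn_small.
Qed.

Lemma layout_in s env out n : 8 < n < 9 + 8 * size s -> layout s env out n.
Proof. by move=> H; rewrite /layout; case_ifs. Qed.

Lemma layout_mid s env out : layout s env out (9 + 8 * size s) = None.
Proof. by rewrite /layout; case_ifs. Qed.

Lemma layout_out s env out i :
  layout s env out (10 + 8 * size s + i) = nth None (map Some out) i.
Proof.
rewrite /layout; case_ifs.
by congr nth; lia.
Qed.

Lemma layout_out_some s env out n :
  9 + 8 * size s < n < 10 + 8 * size s + size out -> layout s env out n.
Proof.
move=> H; have -> : n = 10 + 8 * size s + (n - (10 + 8 * size s)) by lia.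
by rewrite layout_out (nth_map false) //; lia.
Qed.

Lemma layout_end s env out : layout s env out (10 + 8 * size s + size out) = None.
Proof. by rewrite layout_out nth_default // size_map. Qed.

Lemma layout_emit s env out b :
  upd (layout s env out) (10 + 8 * size s + size out) (Some b)
  = layout s env (rcons out b).
Proof.
apply: functional_extensionality => n; rewrite /upd.
case: eqP => [->|ne].
  by rewrite layout_out map_rcons nth_rcons size_map ltnn eqxx.
rewrite /layout; do 3! case: ifP => // ?.
rewrite map_rcons nth_rcons size_map; case: ltnP => // ?.
by rewrite nth_default ?size_map ?ifN //; apply/eqP; lia.
Qed.

(** The marks of a variable fill an initial segment of the blocks, so setting the first clear one
    increments the variable. *)
Lemma layout_mark s env out j v :
  j < size s -> v < 3 -> env v = j ->
  upd (layout s env out) (9 + 8 * j + v) (Some true)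
  = layout s (set_env env v j.+1) out.
Proof.
move=> hj hv e; apply: functional_extensionality => n; rewrite /upd.
case: eqP => [->|ne].
  rewrite layout_block //; last by lia.
  by rewrite /bit_at hv /set_env eqxx ltnSn.
rewrite /layout; case: ifP => // h1; case: ifP => // h2.
congr Some; rewrite /bit_at /set_env; case: ifP => // h3.
case: eqP => // h4; rewrite h4 e; move: ne.
rewrite {1}(_ : n = 9 + 8 * ((n - 9) %/ 8) + v); last by lia.
by move=> ne; apply/idP/idP; lia.
Qed.

Lemma layout_unmark s env out j v :
  j < size s -> v < 3 -> env v = j.+1 ->
  upd (layout s env out) (9 + 8 * j + v) (Some false)
  = layout s (set_env env v j) out.
Proof.
move=> hj hv e; apply: functional_extensionality => n; rewrite /upd.
case: eqP => [->|ne].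
  rewrite layout_block //; last by lia.
  by rewrite /bit_at hv /set_env eqxx ltnn.
rewrite /layout; case: ifP => // h1; case: ifP => // h2.
congr Some; rewrite /bit_at /set_env; case: ifP => // h3.
case: eqP => // h4; rewrite h4 e; move: ne.
rewrite {1}(_ : n = 9 + 8 * ((n - 9) %/ 8) + v); last by lia.
by move=> ne; apply/idP/idP; lia.
Qed.


Definition emit (b : bool) : prog :=
  PSeq mvR (PSeq goR (PSeq mvR (PSeq goR (PSeq (wr (Some b)) (PSeq goL goL))))).

Lemma run_home s env out n :
  8 < n <= 9 + 8 * size s ->
  runs goL (tape_at (layout s env out) n) (8 * size s * 3 + 4) (home s env out).
Proof.
move=> H; apply: runsW (run_goL (j := 8) _ _ _) _; try lia.
  by move=> k hk; apply: layout_in; lia.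
exact: layout_lo.
Qed.

Lemma run_emit b s env out :
  runs (emit b) (home s env out) (100 * (size s + size out + 1))
       (home s env (rcons out b)).
Proof.
apply: runs_seq (run_mvR _ _) _ _.
apply: runs_seq (run_goR (j := 9 + 8 * size s) _ _ _) _ _; first by lia.
  by move=> n hn; apply: layout_in; lia.
  exact: layout_mid.
apply: runs_seq (run_mvR _ _) _ _.
apply: runs_seq (run_goR (j := 10 + 8 * size s + size out) _ _ _) _ _; first by lia.
  by move=> n hn; apply: layout_out_some; lia.
  exact: layout_end.
apply: runs_seq (run_wr _ _ _) _ _; first rewrite layout_emit.
apply: runs_seq (run_goL (j := 9 + 8 * size s) _ _ _) _ _; first by lia.
  by move=> n hn; apply: layout_out_some; rewrite size_rcons; lia.
  exact: layout_mid.
apply: run_home; first by lia.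
all: try exact: leqnn.
by lia.
Qed.

(** * Loop programs over the positions of a word *)

(* A loop at depth d binds variable d; [FTest v k p q] branches on bit k of the
   block at the position of variable v. *)
Inductive fprog :=
| FSkip
| FEmit of bool
| FSeq of fprog & fprog
| FFor of fprog
| FTest of nat & nat & fprog & fprog.

Fixpoint den (d : nat) (p : fprog) (s : seq nat) (env : nat -> nat) : seq bool :=
  match p with
  | FSkip => [::]
  | FEmit b => [:: b]
  | FSeq p q => den d p s env ++ den d q s env
  | FFor p => flatten [seq den d.+1 p s (set_env env d i) | i <- iota 0 (size s)]
  | FTest v k p q => if bit_at s env (env v) k then den d p s env else den d q s env
  end.

Fixpoint wf (d : nat) (p : fprog) : bool :=
  match p with
  | FSkip => true
  | FEmit b => true
  | FSeq p q => wf d p && wf d q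
  | FFor p => (d < 3) && wf d.+1 p
  | FTest v k p q => [&& v < d, v < 3, k < 8, wf d p & wf d q]
  end.

(** No state remembers the current position while [p] runs: afterwards it is recovered as the first
    block whose bit [v] is clear. That bit is then set, and the head moves on to the next block. *)
Definition for_body (v : nat) (p : prog) : prog :=
  PSeq goL (PSeq p (PSeq (rep v.+1 mvR) (PSeq (PWhile is1 (rep 8 mvR))
    (PSeq (wr (Some true)) (rep (8 - v) mvR))))).

Definition for_loop (v : nat) (p : prog) : prog :=
  PSeq mvR (PSeq (PWhile isSome (for_body v p))
    (PSeq (rep (8 - v) mvL)
      (PSeq (PWhile isSome (PSeq (wr (Some false)) (rep 8 mvL)))
        (rep (7 - v) mvR)))).

Definition test_bit (v k : nat) (p q : prog) : prog :=
  PSeq (rep v.+1 mvR) (PSeq (PWhile is1 (rep 8 mvR))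
    (PSeq (rep v mvL) (PSeq (rep k mvR) (PIf is1 (PSeq goL p) (PSeq goL q))))).

Fixpoint fcompile (d : nat) (p : fprog) : prog :=
  match p with
  | FSkip => skip
  | FEmit b => emit b
  | FSeq p q => PSeq (fcompile d p) (fcompile d q)
  | FFor p => for_loop d (fcompile d.+1 p)
  | FTest v k p q => test_bit v k (fcompile d p) (fcompile d q)
  end.

Lemma set_env_id env v : set_env env v (env v) = env.
Proof. by apply: functional_extensionality => u; rewrite /set_env; case: eqP => // ->. Qed.

Lemma set_env_set env v i j : set_env (set_env env v i) v j = set_env env v j.
Proof. by apply: functional_extensionality => u; rewrite /set_env; case: eqP. Qed.

Lemma set_env_eq env v i : set_env env v i v = i.
Proof. by rewrite /set_env eqxx. Qed.

Lemma run_skip s env out : runs skip (home s env out) 1 (home s env out).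
Proof. by exists 1 => //; have := EAct id MStay (home s env out). Qed.

Lemma run_find s env out v :
  v < 3 -> env v < size s ->
  runs (PWhile is1 (rep 8 mvR)) (tape_at (layout s env out) (9 + v))
       (19 * size s + 1) (tape_at (layout s env out) (9 + 8 * env v + v)).
Proof.
move=> hv he; have -> : 9 + 8 * env v + v = 9 + v + 8 * env v by lia.
apply: runsW (run_skip1 (n := env v) _ _) _; last by lia.
  move=> i hi; have -> : 9 + v + 8 * i = 9 + 8 * i + v by lia.
  by rewrite layout_block /bit_at ?hv ?hi //; lia.
have -> : 9 + v + 8 * env v = 9 + 8 * env v + v by lia.
by rewrite layout_block /bit_at ?hv ?ltnn //; lia.
Qed.

Lemma run_test_bit v k p q s env out N T :
  v < 3 -> env v < size s -> k < 8 ->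
  runs (if bit_at s env (env v) k then p else q) (home s env out) N T ->
  runs (test_bit v k p q) (home s env out) (N + 43 * size s + 60) T.
Proof.
move=> hv he hk H.
apply: runs_seq (run_repR _ _ _) _ _.
have -> : 8 + v.+1 = 9 + v by lia.
apply: runs_seq (run_find _ hv he) _ _.
apply: runs_seq (run_repL _ _) _ _; first by lia.
have -> : 9 + 8 * env v + v - v = 9 + 8 * env v by lia.
apply: runs_seq (run_repR _ _ _) _ _.
apply: runs_if; rewrite /scanned /= layout_block //.
have G r : runs r (home s env out) N T ->
    runs (PSeq goL r) (tape_at (layout s env out) (9 + 8 * env v + k))
      (N + 24 * size s + 5) T.
  move=> Hr; apply: runs_seq (run_home _ _ _) Hr _; by lia.
move: H; case: (bit_at _ _ _ _) => /= H; exact: G H.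
all: try exact: leqnn.
by lia.
Qed.

Lemma run_for_body v p s env out out' i N :
  v < 3 -> i < size s ->
  runs p (home s (set_env env v i) out) N (home s (set_env env v i) out') ->
  runs (for_body v p) (tape_at (layout s (set_env env v i) out) (9 + 8 * i))
       (N + 43 * size s + 60)
       (tape_at (layout s (set_env env v i.+1) out') (9 + 8 * i.+1)).
Proof.
move=> hv hi H.
apply: runs_seq (run_home _ _ _) _ _; first by lia.
apply: runs_seq H _ _.
apply: runs_seq (run_repR _ _ _) _ _.
have -> : 8 + v.+1 = 9 + v by lia.
apply: runs_seq (run_find _ hv _) _ _; first by rewrite set_env_eq.
rewrite set_env_eq.
apply: runs_seq (run_wr _ _ _) _ _.
rewrite layout_mark ?set_env_eq // set_env_set.
have -> : 9 + 8 * i.+1 = 9 + 8 * i + v + (8 - v) by lia.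
exact: run_repR.
all: try exact: leqnn.
by lia.
Qed.

(** Marks are removed from the right, so that they remain an initial segment. The last stride of 8
    leaves block 0 for cell [1 + v], a blank that stops the loop; the margin up to cell 8 exists for
    this. *)
Lemma run_clear v s env out :
  v < 3 ->
  runs (PWhile isSome (PSeq (wr (Some false)) (rep 8 mvL)))
       (tape_at (layout s (set_env env v (size s)) out) (1 + 8 * size s + v))
       (size s * 22 + 1)
       (tape_at (layout s (set_env env v 0) out) (1 + v)).
Proof.
move=> hv.
have := @runs_while isSome (PSeq (wr (Some false)) (rep 8 mvL))
  (fun i => tape_at (layout s (set_env env v (size s - i)) out)
                    (1 + 8 * (size s - i) + v)) (size s) 20.
cbv beta; rewrite subn0 subnn => H; apply: H.
  move=> i hi; set j := size s - i.+1; have hj : j < size s by lia.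
  have -> : size s - i = j.+1 by lia.
  have -> : 1 + 8 * j.+1 + v = 9 + 8 * j + v by lia.
  split; first by rewrite /scanned /= layout_block //; lia.
  apply: runs_seq (run_wr _ _ _) _ _.
  rewrite layout_unmark ?set_env_eq // set_env_set.
  have -> : 1 + 8 * j + v = 9 + 8 * j + v - 8 by lia.
  by apply: run_repL; lia.
  by [].
by rewrite /scanned /= layout_lo //; lia.
Qed.

Lemma run_for_loop v p s env out (o : nat -> seq bool) N :
  v < 3 -> env v = 0 -> o 0 = out ->
  (forall i, i < size s ->
     runs p (home s (set_env env v i) (o i)) N (home s (set_env env v i) (o i.+1))) ->
  runs (for_loop v p) (home s env out)
       (size s * (N + 43 * size s + 84) + 100) (home s env (o (size s))).
Proof.
move=> hv he <- H.
have E : set_env env v 0 = env by rewrite -he set_env_id.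
apply: runs_seq (run_mvR _ _) _ _.
have := @runs_while isSome (for_body v p)
  (fun i => tape_at (layout s (set_env env v i) (o i)) (9 + 8 * i)) (size s)
  (N + 43 * size s + 60).
rewrite /= muln0 addn0 E => K.
apply: runs_seq (K _ _) _ _ => {K}.
- move=> i hi; split; last by apply: run_for_body; auto.
  by rewrite /scanned /=; apply: layout_in; lia.
- by rewrite /scanned /= layout_mid.
apply: runs_seq (run_repL _ _) _ _; first by lia.
have -> : 9 + 8 * size s - (8 - v) = 1 + 8 * size s + v by lia.
apply: runs_seq (run_clear _ _ _ hv) _ _.
have := run_repR (layout s env (o (size s))) (1 + v) (7 - v).
have -> : 1 + v + (7 - v) = 8 by lia.
by rewrite E; exact.
all: try exact: leqnn.
by nia.
Qed.

Lemma flatten_map_rcons (T : eqType) (f : nat -> seq T) n :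
  flatten [seq f i | i <- iota 0 n.+1] = flatten [seq f i | i <- iota 0 n] ++ f n.
Proof. by rewrite -addn1 iotaD map_cat flatten_cat /= cats0. Qed.

Definition env_ok (d : nat) (s : seq nat) (env : nat -> nat) : Prop :=
  (forall v, v < d -> env v < size s) /\ (forall v, d <= v -> env v = 0).

Lemma env_ok_set d s env i :
  env_ok d s env -> i < size s -> env_ok d.+1 s (set_env env d i).
Proof.
move=> [h1 h2] hi; split=> v; rewrite /set_env; case: eqP => // ne hv.
  by apply: h1; lia.
  by lia.
by apply: h2; lia.
Qed.

Lemma leq_exp_const c X : 1 < X -> c <= X ^ c.
Proof. by move=> hX; apply: ltnW; apply: ltn_expl. Qed.

Lemma leq_exp_weaken X a b : 1 < X -> a <= b -> X ^ a <= X ^ b.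
Proof. by move=> hX h; apply: leq_pexp2l => //; lia. Qed.

Lemma exp_add_le X a b : 1 < X -> X ^ a + X ^ b <= X ^ (a + b).+1.
Proof.
move=> hX; rewrite expnS.
have := leq_exp_weaken hX (leq_addr b a); have := leq_exp_weaken hX (leq_addl a b).
by nia.
Qed.

(** Each emission walks over all output written so far, hence the factor [size out + 1]. Output
    length and time are bounded together because later parts of a program meet the output of earlier
    ones. *)
Lemma fcompile_correct p d : wf d p ->
  exists a, forall s env, env_ok d s env ->
    size (den d p s env) <= (size s + 2) ^ a /\
    forall out, runs (fcompile d p) (home s env out)
      ((size s + 2) ^ a * (size out + 1)) (home s env (out ++ den d p s env)).
Proof.
have hX (s : seq nat) : 1 < size s + 2 by lia.
elim: p d => [|b|p IHp q IHq|p IH|v k p IHp q IHq] d /=.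
- move=> _; exists 0 => s env _; split=> // out; rewrite cats0.
  by apply: runsW (run_skip _ _ _) _; rewrite expn0; lia.
(* The constant 100 of [run_emit] is at most [(size s + 2) ^ 100]; one more power pays for the
   length of [s]. *)
- move=> _; exists 101 => s env _; split; first by rewrite expn_gt0 addn2.
  move=> out; rewrite cats1; apply: runsW (run_emit _ _ _ _) _.
  have := leq_exp_const 100 (hX s); rewrite (expnS _ 100).
  move: ((size s + 2) ^ 100) => Y hY.
  apply: leq_trans (_ : Y * (size s + size out + 1) <= _).
    by rewrite leq_mul2r hY orbT.
  by rewrite -mulnA mulnCA leq_mul2l; apply/orP; right; nia.
- case/andP=> /IHp[a Ha] /IHq[b Hb]; exists (a + b + 3) => s env ok.
  have [sa Ra] := Ha s env ok; have [sb Rb] := Hb s env ok.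
  have hab := exp_add_le a b (hX s).
  have h3 : (size s + 2) ^ (a + b).+1 * 4 <= (size s + 2) ^ (a + b + 3).
    rewrite (_ : a + b + 3 = (a + b).+1 + 2); last by lia.
    by rewrite [in X in _ <= X]expnD leq_mul2l; apply/orP; right; nia.
  have hp : (size s + 2) ^ a * (size s + 2) ^ b <= (size s + 2) ^ (a + b).+1.
    by rewrite -expnD; apply: leq_exp_weaken.
  split; first by rewrite size_cat; lia.
  move=> out; rewrite catA; apply: runs_seq (Ra out) (Rb _) _.
  rewrite size_cat.
  have ha0 : 0 < (size s + 2) ^ a by rewrite expn_gt0 addn2.
  have hb0 : 0 < (size s + 2) ^ b by rewrite expn_gt0 addn2.
  move: sa sb hab h3 hp ha0 hb0; move: ((size s + 2) ^ a) ((size s + 2) ^ b)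
    ((size s + 2) ^ (a + b).+1) ((size s + 2) ^ (a + b + 3)) => A B C D.
  move: (size (den d p s env)) (size out) => u o hu _ hAB hCD hAB' hA hB.
  have : B * u <= C by apply: leq_trans hAB'; rewrite mulnC leq_mul2r hu orbT.
  by nia.
(* One [a] is for the cost of a round, the other for the output accumulated by earlier rounds; of
   the remaining 12, nine powers exceed 256 and three absorb factors linear in the length. *)
- case/andP=> hd /IH[a Ha]; exists (a + a + 12) => s env ok.
  pose f i := den d.+1 p s (set_env env d i).
  pose g i := flatten [seq f j | j <- iota 0 i].
  have sf i : i < size s -> size (f i) <= (size s + 2) ^ a.
    by move=> hi; have [] := Ha s _ (env_ok_set ok hi).
  have sg i : i <= size s -> size (g i) <= size s * (size s + 2) ^ a.
    move=> hi; apply: leq_trans (_ : i * (size s + 2) ^ a <= _); last first.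
      by rewrite leq_mul2r hi orbT.
    elim: i hi => // i IHi hi.
    rewrite /g flatten_map_rcons size_cat mulSn addnC leq_add ?sf //.
    by apply: IHi; lia.
  have ha0 : 0 < (size s + 2) ^ a by rewrite expn_gt0 addn2.
  have E : (size s + 2) ^ (a + a + 12)
         = (size s + 2) ^ a * (size s + 2) ^ a * (size s + 2) ^ 9 *
           ((size s + 2) * (size s + 2) * (size s + 2)).
    rewrite (_ : a + a + 12 = a + a + 9 + 3); last by lia.
    by rewrite expnD [X in _ * X](_ : _ = (size s + 2) * (size s + 2) * (size s + 2))
      ?(expnD _ _ 9) ?(expnD _ a) // !expnS expn0 muln1 mulnA.
  have h9 : 256 <= (size s + 2) ^ 9.
    by apply: leq_trans (_ : 2 ^ 9 <= _) => //; apply: leq_exp_base; lia.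
  split.
    apply: leq_trans (sg _ (leqnn _)) _; rewrite E.
    move: ha0 h9; move: ((size s + 2) ^ a) ((size s + 2) ^ 9) => A B hA hB.
    apply: leq_trans (_ : (size s + 2) * A <= _); first by nia.
    rewrite mulnC; apply: leq_mul; last by rewrite -mulnA leq_pmulr //; nia.
    by rewrite -mulnA leq_pmulr // muln_gt0 hA (leq_trans _ hB).
  move=> out.
  pose N := (size s + 2) ^ a * (size out + size s * (size s + 2) ^ a + 1).
  apply: runsW (@run_for_loop d _ s env out (fun i => out ++ g i) N hd _ _ _) _.
  + by case: ok => _; apply.
  + by rewrite /= cats0.
  + move=> i hi; rewrite [g i.+1]flatten_map_rcons catA.
    have [_ /(_ (out ++ g i)) R] := Ha s _ (env_ok_set ok hi).
    apply: runsW R _; rewrite /N leq_mul2l; apply/orP; right.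
    by rewrite size_cat leq_add2r leq_add2l sg // ltnW.
  rewrite E /N.
  move: ha0 h9; move: ((size s + 2) ^ a) ((size s + 2) ^ 9) => A B hA hB.
  move: (size s) (size out) => m o.
  apply: leq_trans (_ : A * A * 256 * ((m + 2) * (m + 2) * (m + 2)) * (o + 1) <= _).
    pose Z := (m + 2) * (o + 1).
    have hZ : m + 2 <= Z by rewrite /Z leq_pmulr // addn1.
    have h1 : A * (o + m * A + 1) <= A * A * Z.
      rewrite -mulnA leq_mul2l; apply/orP; right.
      have h1a : o + 1 <= A * (o + 1) by rewrite leq_pmull.
      have h1b : m * A <= A * (m * (o + 1)).
        by rewrite mulnC leq_mul2l leq_pmulr ?orbT ?addn1.
      by rewrite /Z; nia.
    have -> : A * A * 256 * ((m + 2) * (m + 2) * (m + 2)) * (o + 1)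
            = A * A * Z * (256 * ((m + 2) * (m + 2))) by rewrite /Z; lia.
    have h2 : Z <= A * A * Z by rewrite leq_pmull // muln_gt0 hA.
    move: h1 h2; move: (A * (_ + 1)) (A * A * Z) => C D h1 h2.
    apply: leq_trans (_ : D * (m * 44 + 100) <= _); first by nia.
    by rewrite leq_mul2l; apply/orP; right; nia.
  rewrite !leq_mul2r; apply/orP; right; apply/orP; right.
  by rewrite leq_mul2l hB orbT.
- case/and5P=> hv hv3 hk /IHp[a Ha] /IHq[b Hb]; exists (a + b + 9) => s env ok.
  have [sa Ra] := Ha s env ok; have [sb Rb] := Hb s env ok.
  have he : env v < size s by case: ok => h _; exact: h.
  have key (c : nat) : c <= a + b -> (size s + 2) ^ c + 43 * size s + 60 <= (size s + 2) ^ (a + b + 9).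
    move=> hc; have h := leq_exp_weaken (hX s) hc.
    have h0 : 0 < (size s + 2) ^ (a + b) by rewrite expn_gt0 addn2.
    rewrite expnD (_ : 9 = 8 + 1) // (expnD _ 8) expn1.
    have h8 : 256 <= (size s + 2) ^ 8.
      by apply: leq_trans (_ : 2 ^ 8 <= _) => //; apply: leq_exp_base; lia.
    apply: leq_trans (_ : (size s + 2) ^ (a + b) * (256 * (size s + 2)) <= _).
      by nia.
    by rewrite leq_mul2l leq_mul2r h8 !orbT.
  have key2 c o : c <= a + b -> (size s + 2) ^ c * (o + 1) + 43 * size s + 60
       <= (size s + 2) ^ (a + b + 9) * (o + 1).
    by move=> /key hc; nia.
  have [ha hb] : a <= a + b /\ b <= a + b by lia.
  split.
    case: ifP => _; first by apply: leq_trans sa _; have := key a ha; lia.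
    by apply: leq_trans sb _; have := key b hb; lia.
  move=> out; case e: (bit_at s env (env v) k).
    by apply: runsW (run_test_bit hv3 he hk _) (key2 a _ ha); rewrite e; apply: Ra.
  by apply: runsW (run_test_bit hv3 he hk _) (key2 b _ hb); rewrite e; apply: Rb.
Qed.

(** * Composing polynomial-time tape programs *)

(** With an index type [X], a stage of a pipeline has to be correct only on the words [u x] that
    earlier stages produce. The length bound on [v x] is what keeps compositions polynomial. *)
Definition poly_computes (X : Type) (u v : X -> seq bool) : Prop :=
  exists p a, forall x,
    runs p (bits_tape (u x)) ((size (u x) + 2) ^ a) (bits_tape (v x)) /\
    size (v x) <= (size (u x) + 2) ^ a.

Lemma poly_computes_time (f : seq bool -> seq bool) :
  poly_computes id f -> poly_time f.
Proof. by case=> p [a H]; apply: (@prog_poly_time p f a) => x; have [] := H x. Qed.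

Lemma poly_computes_trans X (u v w : X -> seq bool) :
  poly_computes u v -> poly_computes v w -> poly_computes u w.
Proof.
(* The intermediate word has length at most [Y ^ a], where [Y = size (u x) + 2], and
   [Y ^ a + 2 <= Y ^ (a + 2)]; this gives [(a + 2) * b] for the second stage. *)
case=> p [a Hp] [q [b Hq]]; exists (PSeq p q), (a + (a + 2) * b + 2) => x.
have [Rp sp] := Hp x; have [Rq sq] := Hq x.
set Y := size (u x) + 2 in Rp sp *; have hY : 1 < Y by rewrite /Y; lia.
have hb : (size (v x) + 2) ^ b <= Y ^ ((a + 2) * b).
  rewrite expnM; apply: leq_exp_base; rewrite expnD.
  have : 0 < Y ^ a by rewrite expn_gt0 ltnW.
  by have : 4 <= Y ^ 2; [rewrite expnS expn1|]; nia.
have h0 : 0 < Y ^ a by rewrite expn_gt0 ltnW.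
have h1 : 0 < Y ^ ((a + 2) * b) by rewrite expn_gt0 ltnW.
have h2 : 4 <= Y ^ 2 by rewrite expnS expn1; nia.
have h3 : Y ^ a * Y ^ ((a + 2) * b) * 4 <= Y ^ (a + (a + 2) * b + 2).
  by rewrite !expnD leq_mul2l h2 orbT.
move: Rp sp hb h0 h1 h3; move: (Y ^ a) (Y ^ ((a + 2) * b)) (Y ^ (a + (a + 2) * b + 2)).
move=> A B C Rp sp hb h0 h1 h3.
split; last by apply: leq_trans sq _; apply: leq_trans hb _; nia.
by apply: runs_seq Rp Rq _; nia.
Qed.

Definition env0 : nat -> nat := fun=> 0.

Definition letter_bits (a : nat) : seq bool :=
  mkseq (fun b => (2 < b) && (b == 3 + a)) 8.

Definition enc (s : seq nat) : seq bool := flatten (map letter_bits s).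

Lemma enc_cons a s : enc (a :: s) = letter_bits a ++ enc s.
Proof. by []. Qed.

Lemma size_enc s : size (enc s) = 8 * size s.
Proof. by elim: s => // a s IH; rewrite enc_cons size_cat IH size_mkseq /=; lia. Qed.

Lemma nth_enc s j b :
  j < size s -> b < 8 -> nth false (enc s) (8 * j + b) = bit_at s env0 j b.
Proof.
elim: s j => // a s IH [|j] hj hb; rewrite enc_cons nth_cat size_mkseq.
  rewrite muln0 hb nth_mkseq // /bit_at /env0 /=.
  by rewrite leqNgt; case: (b < 3).
rewrite ifN; last by lia.
have -> : 8 * j.+1 + b - 8 = 8 * j + b by lia.
by rewrite IH.
Qed.

Lemma layout_enc s k :
  layout s env0 [::] (9 + k) = nth None (map Some (enc s)) k.
Proof.
rewrite /layout; case_ifs.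
- have -> : 9 + k - 9 = k by lia.
  rewrite (nth_map false) ?size_enc; last by lia.
  rewrite -nth_enc; last by lia.
    by congr (Some (nth _ _ _)); lia.
  by lia.
- by rewrite nth_default // size_map size_enc; lia.
- by rewrite nth_nil nth_default // size_map size_enc; lia.
Qed.

Lemma bits_tape_at (f : nat -> cell) k (x : seq bool) :
  (forall n, n < k -> f n = None) -> (forall n, f (k + n) = nth None (map Some x) n) ->
  tape_at f k = bits_tape x.
Proof.
move=> H1 H2; rewrite /tape_at /bits_tape; congr (_, _, _).
- apply: functional_extensionality => n; case: ltnP => // h.
  by apply: H1; lia.
- by have := H2 0; rewrite addn0 => ->; case: x {H2}.
- by apply: functional_extensionality => n; rewrite H2; case: x {H2} => //=; case: n.
Qed.

(** Wiping the blocks leaves only blanks to the left of the output, which is the input format of the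
    next stage. *)
Definition erase : prog := PWhile isSome (PSeq (wr None) mvR).

Definition fprog_prog (p : fprog) : prog :=
  PSeq mvL (PSeq (fcompile 0 p) (PSeq mvR (PSeq erase mvR))).

Lemma run_erase s out :
  runs (PSeq mvR (PSeq erase mvR)) (home s env0 out) (48 * size s + 5) (bits_tape out).
Proof.
pose f i n := if n < 9 + i then None else layout s env0 out n.
have E : layout s env0 out = f 0.
  by apply: functional_extensionality => n; rewrite /f; case: ltnP => // h; rewrite layout_lo.
have M : runs mvR (tape_at (f (8 * size s)) (9 + 8 * size s)) 1 (bits_tape out).
  have -> : bits_tape out = tape_at (f (8 * size s)) (9 + 8 * size s).+1.
    apply/esym; apply: bits_tape_at => n; last first.
      by rewrite /f; case_ifs; rewrite -(layout_out s env0); congr layout; lia.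
    move=> h2; rewrite /f; case: ltnP => // h1.
    by rewrite (_ : n = 9 + 8 * size s) ?layout_mid //; lia.
  exact: run_mvR.
apply: runs_seq (run_mvR _ _) _ _.
rewrite E; have := @runs_while isSome (PSeq (wr None) mvR)
  (fun i => tape_at (f i) (9 + i)) (8 * size s) 3.
rewrite /= addn0 => K; apply: runs_seq (K _ _) M _ => {K}.
- move=> i hi; split; first by rewrite /scanned /= /f ltnn layout_in //; lia.
  apply: runs_seq (run_wr _ _ _) _ _.
    have -> : upd (f i) (9 + i) None = f i.+1.
      apply: functional_extensionality => n; rewrite /upd /f.
      by case: eqP => h; case_ifs.
    by rewrite addnS; apply: run_mvR.
  by [].
- by rewrite /scanned /= /f ltnn layout_mid.
- exact: leqnn.
by lia.
Qed.

Lemma fprog_poly_computes X (h : X -> seq nat) p : wf 0 p ->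
  poly_computes (fun x => enc (h x)) (fun x => den 0 p (h x) env0).
Proof.
move=> wfp; have [a Ha] := fcompile_correct wfp.
exists (fprog_prog p), (a + 7) => x; rewrite size_enc.
have [ok] : env_ok 0 (h x) env0 by [].
have [sd /(_ [::]) R] := Ha (h x) env0 (conj ok (fun _ _ => erefl)) => _.
have hq : (size (h x) + 2) ^ a <= (8 * size (h x) + 2) ^ a.
  by apply: leq_exp_base; lia.
have h7 : 100 <= (8 * size (h x) + 2) ^ 6 * 2.
  have : 64 <= (8 * size (h x) + 2) ^ 6.
    by apply: leq_trans (_ : 2 ^ 6 <= _) => //; apply: leq_exp_base; lia.
  by move: (_ ^ 6) => Y hY; lia.
have h0 : 0 < (8 * size (h x) + 2) ^ a by rewrite expn_gt0 addn2.
have h8 : (8 * size (h x) + 2) ^ a + 50 * size (h x) + 50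
          <= (8 * size (h x) + 2) ^ (a + 7).
  rewrite expnD (expnD _ 6 1) expn1.
  move: h7 h0; move: (_ ^ 6) (_ ^ a) => B A hB hA.
  apply: leq_trans (_ : A * (50 * size (h x) + 51) <= _); first by nia.
  by rewrite leq_mul2l; apply/orP; right; nia.
split; last by apply: leq_trans sd _; lia.
have -> : bits_tape (enc (h x)) = tape_at (layout (h x) env0 [::]) 9.
  apply/esym; apply: bits_tape_at => n; last exact: layout_enc.
  by move=> hn; rewrite layout_lo.
apply: runs_seq (run_mvL _ _) _ _.
apply: runs_seq R (run_erase _ _) _.
all: try exact: leqnn.
by rewrite /= add0n muln1; lia.
Qed.

(** * Loading the input into blocks *)

Fixpoint put (bs : seq bool) : prog :=
  if bs is b :: bs' then PSeq (wr (Some b)) (PSeq mvR (put bs')) else skip.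

(** The blank left by the erased bit serves as the marker to which the head returns after appending
    a block behind the input. *)
Definition load_letter (a : nat) : prog :=
  PSeq (wr None) (PSeq mvR (PSeq goR (PSeq mvR (PSeq goR
    (PSeq (put (letter_bits a)) (PSeq goL (PSeq goL mvR))))))).

Definition load : prog :=
  PSeq (PWhile isSome (PIf is1 (load_letter 1) (load_letter 0))) mvR.

Definition load_tape (x : seq bool) (i : nat) (out : seq bool) (n : nat) : cell :=
  if n < i then None else
  if n <= size x then nth None (map Some x) n
  else nth None (map Some out) (n - (size x).+1).

Lemma run_put x i out bs : i <= size x ->
  runs (put bs) (tape_at (load_tape x i out) ((size x).+1 + size out))
    (5 * size bs + 1)
    (tape_at (load_tape x i (out ++ bs)) ((size x).+1 + size (out ++ bs))).
Proof.
move=> hi; elim: bs out => [|b bs IH] out /=.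
  rewrite cats0; exists 1 => //.
  by have := EAct id MStay (tape_at (load_tape x i out) ((size x).+1 + size out)).
apply: runs_seq (run_wr _ _ _) _ _.
  have -> : upd (load_tape x i out) ((size x).+1 + size out) (Some b)
          = load_tape x i (rcons out b).
    apply: functional_extensionality => n; rewrite /upd /load_tape.
    case: eqP => [->|ne].
      case_ifs; rewrite map_rcons nth_rcons size_map.
      by rewrite (_ : _ - _ = size out) ?ltnn ?eqxx //; lia.
    do 2! case: ifP => // ?.
    rewrite map_rcons nth_rcons size_map; case: ltnP => // ?.
    by rewrite nth_default ?size_map ?ifN //; lia.
  apply: runs_seq (run_mvR _ _) _ _; last exact: leqnn.
  by have K := IH (rcons out b); rewrite cat_rcons size_rcons addnS in K; apply: K.
by lia.
Qed.

Lemma run_load_letter x i out a : i < size x ->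
  runs (load_letter a) (tape_at (load_tape x i out) i)
    (8 * size x + 8 * size out + 150)
    (tape_at (load_tape x i.+1 (out ++ letter_bits a)) i.+1).
Proof.
move=> hi.
have xin n j o : j <= n < size x -> load_tape x j o n.
  by move=> h; rewrite /load_tape; case_ifs; rewrite (nth_map false) //; lia.
have xmid j o : load_tape x j o (size x) = None.
  by rewrite /load_tape; case_ifs; rewrite // nth_default // size_map.
have xout n j o : j <= size x -> size x < n < (size x).+1 + size o -> load_tape x j o n.
  move=> h h'; rewrite /load_tape; case_ifs; rewrite (nth_map false) //; lia.
have xend j o : j <= size x -> load_tape x j o ((size x).+1 + size o) = None.
  by move=> h; rewrite /load_tape; case_ifs; rewrite nth_default // size_map; lia.
apply: runs_seq (run_wr _ _ _) _ _.
have -> : upd (load_tape x i out) i None = load_tape x i.+1 out.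
  apply: functional_extensionality => n; rewrite /upd /load_tape.
  by case: eqP => h; case_ifs.
apply: runs_seq (run_mvR _ _) _ _.
apply: runs_seq (run_goR (j := size x) _ _ _) _ _ => //; first by move=> n hn; exact: xin.
apply: runs_seq (run_mvR _ _) _ _.
apply: runs_seq (run_goR (j := (size x).+1 + size out) _ _ _) _ _; first by lia.
  by move=> n hn; apply: xout; lia.
  by apply: xend.
apply: runs_seq (run_put _ _ _) _ _ => //.
apply: runs_seq (run_goL (j := size x) _ _ _) _ _; first by lia.
  by move=> n hn; apply: xout; lia.
  by [].
apply: runs_seq (run_goL (j := i) _ _ _) (run_mvR _ _) _ => //.
  by move=> n hn; apply: xin; lia.
  by rewrite /load_tape; case_ifs.
all: try exact: leqnn.
by rewrite size_cat size_mkseq; lia.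
Qed.

Lemma load_poly_computes : poly_computes id (fun x => enc (map nat_of_bool x)).
Proof.
exists load, 12 => x; rewrite size_enc size_map.
have h12 : 1000 * (size x + 1) * (size x + 1) <= (size x + 2) ^ 12.
  rewrite (expnD _ 10 2) (expnS _ 1) expn1.
  have : 1024 <= (size x + 2) ^ 10.
    by apply: leq_trans (_ : 2 ^ 10 <= _) => //; apply: leq_exp_base; lia.
  by move: (_ ^ 10) => Y hY; nia.
split; last by apply: leq_trans h12; nia.
pose o i := enc (map nat_of_bool (take i x)).
have := @runs_while isSome (PIf is1 (load_letter 1) (load_letter 0))
  (fun i => tape_at (load_tape x i (o i)) i) (size x) (72 * size x + 160).
rewrite {1}(_ : tape_at (load_tape x 0 (o 0)) 0 = bits_tape x); last first.
  apply: bits_tape_at => // n; rewrite /load_tape; case_ifs => //.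
  by rewrite /o take0 nth_nil nth_default // size_map; lia.
move=> K; apply: runs_seq (K _ _) _ _ => {K}.
- move=> i hi.
  have e : load_tape x i (o i) i = Some (nth false x i).
    by rewrite /load_tape; case_ifs; rewrite (nth_map false).
  split; first by rewrite /scanned /= e.
  apply: (@runsW _ _ (8 * size x + 8 * size (o i) + 150).+1); first apply: runs_if.
    rewrite /scanned /= e (_ : o i.+1 = o i ++ letter_bits (nth false x i)).
      by case: (nth false x i); apply: run_load_letter.
    by rewrite /o (take_nth false) // map_rcons /enc -cats1 map_cat flatten_cat -[in RHS](cats0 (letter_bits _)).
  by rewrite /o size_enc size_map size_take hi; lia.
- by rewrite /scanned /= /load_tape ltnn leqnn nth_default // size_map.
- have -> : bits_tape (enc (map nat_of_bool x))
          = tape_at (load_tape x (size x) (o (size x))) (size x).+1.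
    apply/esym; apply: bits_tape_at => n; rewrite /load_tape.
      by case_ifs => // h; rewrite nth_default // size_map; lia.
    by case_ifs; rewrite /o take_size; congr nth; lia.
  exact: run_mvR.
by nia.
Qed.

(** * Refutations with ordered pivots *)

Local Open Scope fset_scope.

Definition sat_clause (al : nat -> bool) (C : clause) : Prop :=
  exists2 l : lit, l \in C & al l.1 = l.2.

Definition satisfies (al : nat -> bool) (cs : seq (seq lit)) : Prop :=
  forall c, c \in cs -> exists2 l : lit, l \in c & al l.1 = l.2.

Lemma satisfies_formula al cs C :
  satisfies al cs -> formula_of cs C -> sat_clause al C.
Proof.
move=> H /mapP[c hc ->]; have [l hl e] := H c hc.
by exists l => //; rewrite inE.
Qed.

Lemma resolution_sound cs al P :
  is_resolution_proof (formula_of cs) P -> ~ satisfies al cs.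
Proof.
move=> [_ [Hn [Hroot _]]] Hsat.
suff H n (i : 'I_(rd_size P)) : i <= n -> sat_clause al (rd_lab P i).
  by have [l] := H _ _ (leqnn (rd_root P)); rewrite Hroot inE.
elim: n i => [|n IH] i hi; have := Hn i; case: (rd_kind P i) => [[[a b] v]|];
  try exact: satisfies_formula.
  by case; lia.
case=> ha hb _ _ ->; have [|l1 h1 e1] := IH a; first by lia.
have [|l2 h2 e2] := IH b; first by lia.
case: (boolP (al v)) => hv.
  exists l2 => //; rewrite !inE h2 andbT; apply/orP; right.
  by apply/eqP => e; move: e2; rewrite e /= hv.
exists l1 => //; rewrite !inE h1 andbT; apply/orP; left.
by apply/eqP => e; move: e1; rewrite e /= (negbTE hv).
Qed.

Definition height (C : clause) : nat := \max_(l <- C) l.1.+1.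

Lemma height_leP C n : reflect (forall l : lit, l \in C -> l.1 < n) (height C <= n).
Proof.
apply: (iffP (bigmax_leqP_seq _ _ _ _)) => H l hl; first exact: H.
by move=> _; exact: H.
Qed.

(* Derivations in which the pivot is the largest variable of both premises:
   along a path from the root the pivots strictly increase. *)
Inductive derivable (F : pred clause) : clause -> Prop :=
| DLeaf C : F C -> derivable F C
| DRes A B v : derivable F A -> derivable F B ->
    (v, true) \in A -> (v, false) \in B -> height A <= v.+1 -> height B <= v.+1 ->
    height (resolvent A B v) <= v ->
    derivable F (resolvent A B v).

(** A decision tree read from its leaves: every assignment falsifies some input clause, and the
    largest remaining variable is eliminated by resolving the clauses obtained for its two values.
    If one of them lacks the variable, it is kept unchanged. *)
Lemma derivable_complete cs :
  (forall al, ~ satisfies al cs) -> derivable (formula_of cs) fset0.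
Proof.
move=> Hunsat.
pose falsified (al : nat -> bool) (C : clause) :=
  forall l : lit, l \in C -> al l.1 = ~~ l.2.
have [M hM] : exists M, forall C, formula_of cs C -> height C <= M.
  exists (\max_(C <- [seq [fset l in c] | c <- cs]) height C) => C hC.
  exact: (@leq_bigmax_seq _ _ xpredT height).
have H k al : exists C, [/\ derivable (formula_of cs) C, height C <= M - k
                          & falsified al C].
  elim: k al => [|k IH] al.
    have [C [hC hf]] : exists C, formula_of cs C /\ falsified al C.
      apply: NNPP => Hno; apply: (Hunsat al) => c hc.
      apply: NNPP => Hc; apply: Hno; exists [fset l in c]; split.
        by apply/mapP; exists c.
      move=> l; rewrite inE => /= hl; case e: (al l.1); case e2: l.2 => //;
        by case: Hc; exists l => //; rewrite e e2.
    exists C; split=> //; first exact: DLeaf.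
    by rewrite subn0; apply: hM.
  case: (leqP M k) => hk.
    have [C [h1 h2 h3]] := IH al; exists C; split=> //.
    by move: h2; rewrite (eqP (leqW hk)) (eqP hk).
  set v := M - k.+1; have ev : M - k = v.+1 by rewrite /v; lia.
  pose al1 b := fun u => if u == v then b else al u.
  have [A [dA hA fA]] := IH (al1 false); have [B [dB hB fB]] := IH (al1 true).
  rewrite ev in hA hB; move/height_leP: (hA) => hA'; move/height_leP: (hB) => hB'.
  have one b C : height C <= v.+1 -> falsified (al1 b) C -> (v, ~~ b) \notin C ->
      height C <= v /\ falsified al C.
    move=> hC fC nC.
    have ne (l : lit) : l \in C -> l.1 != v.
      move=> hl; apply/eqP => e; have := fC l hl; rewrite /al1 e eqxx => eb.
      by case/negP: nC; rewrite -e eb negbK -surjective_pairing.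
    split.
      apply/height_leP => l hl; have := ne l hl.
      by move/height_leP: hC => /(_ l hl); lia.
    by move=> l hl; have := fC l hl; rewrite /al1 ifN // ne.
  have [vA|nA] := boolP ((v, true) \in A); last first.
    by have [] := one _ _ hA fA nA; exists A.
  have [vB|nB] := boolP ((v, false) \in B); last first.
    by have [] := one _ _ hB fB nB; exists B.
  (* [A] is falsified with [v] false, so its only literal on [v] is the positive one; dually for
     [B]. Hence no literal on [v] survives. *)
  have key (l : lit) : l \in resolvent A B v -> l.1 < v /\ al l.1 = ~~ l.2.
    rewrite !inE; case/orP => /andP[ne hl].
      have := fA l hl; have := hA' l hl; rewrite /al1; case: eqP => [e|ne'].
        by case: l ne hl e => u b /= ne hl e _ eb; case/negP: ne; rewrite e; case: b eb {hl}.
      by move=> ?; split=> //; lia.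
    have := fB l hl; have := hB' l hl; rewrite /al1; case: eqP => [e|ne'].
      by case: l ne hl e => u b /= ne hl e _ eb; case/negP: ne; rewrite e; case: b eb {hl}.
    by move=> ?; split=> //; lia.
  have hR : height (resolvent A B v) <= v by apply/height_leP => l /key[].
  exists (resolvent A B v); split=> //; first exact: DRes.
  by move=> l /key[].
have [C [dC hC _]] := H M (fun=> false).
suff -> : fset0 = C by [].
apply/esym/eqP; rewrite -fsubset0; apply/fsubsetP => l hl.
by move/height_leP: hC => /(_ l hl); rewrite subnn.
Qed.

Definition last_rule_spec (F : pred clause) (C : clause)
    (r : option (clause * clause * nat)) : Prop :=
  match r with
  | None => F C
  | Some (A, B, v) =>
      [/\ derivable F A, derivable F B,
          [/\ (v, true) \in A, (v, false) \in B & C = resolvent A B v] &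
          [/\ height A = v.+1, height B = v.+1 & height C <= v]]
  end.

Lemma last_rule_exists F C :
  exists r, derivable F C -> last_rule_spec F C r.
Proof.
case: (classic (derivable F C)) => [d|]; last by exists None.
case: d => [D hD|A B v dA dB vA vB hA hB hR]; first by exists None.
exists (Some (A, B, v)) => _; split=> //; split=> //; apply/eqP; rewrite eqn_leq ?hA ?hB //=.
  by have /height_leP/(_ _ vA) := leqnn (height A).
by have /height_leP/(_ _ vB) := leqnn (height B).
Qed.

(** Fixing one rule per clause turns derivations, which may derive a clause in several ways, into a
    graph with one node per clause. *)
Definition last_rule F C : option (clause * clause * nat) :=
  projT1 (constructive_indefinite_description _ (last_rule_exists F C)).

Lemma last_ruleP F C : derivable F C -> last_rule_spec F C (last_rule F C).
Proof.
by rewrite /last_rule; case: constructive_indefinite_description.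
Qed.

(** Keeping only the clauses used for the empty one makes the root the unique sink. *)
Inductive reachable (F : pred clause) : clause -> Prop :=
| RRoot : reachable F fset0
| RLeft C A B v : reachable F C -> last_rule F C = Some (A, B, v) -> reachable F A
| RRight C A B v : reachable F C -> last_rule F C = Some (A, B, v) -> reachable F B.

Lemma reachable_derivable F C :
  derivable F fset0 -> reachable F C -> derivable F C.
Proof.
by move=> d0; elim=> [//|D A B v _ /last_ruleP dD e|D A B v _ /last_ruleP dD e];
  move: dD; rewrite e /= => -[].
Qed.

Definition literals (cs : seq (seq lit)) : {fset lit} := [fset l in flatten cs].

Lemma card_literals cs : #|` literals cs| <= size (flatten cs).
Proof. by rewrite card_fseq size_undup. Qed.

(** Nodes are thus subsets of the given literals, which yields the bound [2 ^ size (flatten cs)]. *)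
Lemma derivable_literals cs C : derivable (formula_of cs) C -> C `<=` literals cs.
Proof.
elim=> {C} [C /mapP[c hc ->]|A B v _ hA _ hB _ _ _ _ _].
  apply/fsubsetP => l; rewrite !inE /= => hl.
  by apply/flattenP; exists c.
by rewrite fsubUset !(fsubset_trans (fsubD1set _ _)).
Qed.

Definition decide (P : Prop) : bool :=
  if excluded_middle_informative P then true else false.

Lemma decideP P : reflect P (decide P).
Proof. by rewrite /decide; case: excluded_middle_informative => h; constructor. Qed.

Lemma resolution_complete cs :
  (forall al, ~ satisfies al cs) ->
  exists P, [/\ is_resolution_proof (formula_of cs) P, regular P &
                rd_size P <= 2 ^ size (flatten cs)].
Proof.
move=> Hunsat; have d0 := derivable_complete Hunsat.
set F := formula_of cs in d0.
pose ge_height (A B : clause) := height B <= height A.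
(* Premises resolved on [v] have height [v.+1] and their resolvent at most [v], so decreasing height
   numbers premises before resolvents. *)
pose ns : seq clause :=
  sort ge_height [seq C <- fpowerset (literals cs) | decide (reachable F C)].
have ns_uniq : uniq ns by rewrite sort_uniq filter_uniq // fset_uniq.
have mem_ns C : reachable F C <-> C \in ns.
  rewrite mem_sort mem_filter; split=> [h|/andP[/decideP]//].
  rewrite (introT (decideP _) h) fpowersetE.
  exact: (derivable_literals (reachable_derivable d0 h)).
have ns_size : size ns <= 2 ^ size (flatten cs).
  rewrite size_sort size_filter (leq_trans (count_size _ _)) //.
  by rewrite card_fpowerset leq_pexp2l // card_literals.
have root_ns : fset0 \in ns by apply/mem_ns; exact: RRoot.
have [N eN] : exists N, size ns = N.+1.
  by case: (ns) root_ns => // C s _; exists (size s).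
pose lab (i : 'I_N.+1) : clause := nth fset0 ns i.
pose node (C : clause) : 'I_N.+1 := inord (index C ns).
have labK C : C \in ns -> lab (node C) = C.
  by move=> hC; rewrite /lab inordK ?nth_index // -eN index_mem.
have lab_ns i : lab i \in ns by rewrite mem_nth // eN.
have lab_inj : injective lab.
  move=> i j /eqP; rewrite nth_uniq ?eN // => /eqP; exact: val_inj.
have nodeK i : node (lab i) = i by apply: lab_inj; rewrite labK.
have lt_height i j : height (lab j) < height (lab i) -> i < j.
  move=> lt_ji; rewrite ltnNge; apply/negP => le_ji.
  have : sorted ge_height ns by apply: sort_sorted => A B; exact: leq_total.
  have tr : transitive ge_height by move=> ? ? ? h1 h2; exact: leq_trans h2 h1.
  have rf : reflexive ge_height by move=> ?; exact: leqnn.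
  move/(sorted_leq_nth tr rf fset0) => /(_ j i).
  rewrite !inE !eN => /(_ (ltn_ord j) (ltn_ord i) le_ji).
  by rewrite /ge_height -/(lab i) -/(lab j); lia.
pose kind (i : 'I_N.+1) :=
  if last_rule F (lab i) is Some (A, B, v) then Some (node A, node B, v) else None.
pose P := {| rd_size := N.+1; rd_lab := lab; rd_kind := kind; rd_root := node fset0 |}.
have der i : derivable F (lab i).
  by apply: reachable_derivable => //; apply/mem_ns.
have kindP i a b v : kind i = Some (a, b, v) ->
  [/\ last_rule F (lab i) = Some (lab a, lab b, v),
      [/\ (v, true) \in lab a, (v, false) \in lab b &
          lab i = resolvent (lab a) (lab b) v] &
      [/\ height (lab a) = v.+1, height (lab b) = v.+1 & height (lab i) <= v]].
  rewrite /kind; have := last_ruleP (der i).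
  case e: (last_rule F (lab i)) => [[[A B] w]|] //= [_ _ H1 H2] [<- <- <-].
  have /mem_ns ri := lab_ns i.
  have /mem_ns rA := RLeft ri e; have /mem_ns rB := RRight ri e.
  by rewrite !labK.
exists P; split; [| | by rewrite /= -eN].
  split; first exact: lab_inj.
  split.
    move=> i /=; case e: (kind i) => [[[a b] v]|].
      have [_ [va vb er] [ha hb hi]] := kindP _ _ _ _ e.
      by split=> //; apply: lt_height; rewrite ?ha ?hb; lia.
    move: e; rewrite /kind; have := last_ruleP (der i).
    by case: (last_rule F (lab i)) => [[[A B] w]|].
  split; first by rewrite /= labK.
  move=> u hu; have [C eC] : exists C, C = lab u by exists (lab u).
  have hr : reachable F C by rewrite eC; apply/mem_ns.
  case: C / hr eC => [e|C A B v rC e eu|C A B v rC e eu].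
  - by case/eqP: hu; rewrite -[LHS]nodeK -e.
  - have /mem_ns hC := rC; exists (node C).
    by rewrite /child_to_parent /= /kind labK // e eu nodeK eqxx.
  - have /mem_ns hC := rC; exists (node C).
    by rewrite /child_to_parent /= /kind labK // e eu nodeK eqxx orbT.
(* If [x] has pivot [v], each parent of it has height [v.+1], and the pivot of a rule is at least
   the height of its conclusion: pivots strictly increase away from the root. *)
suff H (p : seq 'I_(rd_size P)) x : path (child_to_parent P) x p ->
    sorted ltn (pmap (pivot P) (x :: p)).
  by move=> p hp _; apply: (sorted_uniq ltn_trans ltnn); exact: H.
elim: p x => [|y p IH] x; first by move=> _ /=; case: (pivot P x).
move=> /= /andP[hxy hp]; have := IH y hp.
move: hxy hp; rewrite /= /child_to_parent /pivot /=.
case ex: (kind x) => [[[a b] v]|] // hxy hp.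
have hy : height (lab y) = v.+1.
  have [_ _ [ha hb _]] := kindP _ _ _ _ ex.
  by case/orP: hxy => /eqP ->.
case ey: (kind y) => [[[a' b'] w]|] /=.
  have [_ _ [_ _ hw]] := kindP _ _ _ _ ey.
  by move=> ->; rewrite andbT /=; lia.
by case: p hp {IH} => // z p /=; rewrite ey.
Qed.

Local Close Scope fset_scope.

(** * Injectivity of the encoding *)

Definition is_digit (s : sym) : bool :=
  match s with S0 => true | S1 => true | _ => false end.

Lemma sym_bits_inj a b :
  flatten (map sym_bits a) = flatten (map sym_bits b) -> a = b.
Proof.
elim: a b => [|x a IH] [|y b] //=; [by case: y | by case: x |].
by case: x; case: y => //= -[/IH ->].
Qed.

Lemma cat_digits_inj a b x y u v :
  all is_digit a -> all is_digit b -> ~~ is_digit x -> ~~ is_digit y ->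
  a ++ x :: u = b ++ y :: v -> [/\ a = b, x = y & u = v].
Proof.
elim: a b => [|s a IH] [|t b] //=.
- by move=> _ _ _ _ [-> ->].
- by move=> _ /andP[ht _] hx _ [e _]; rewrite e ht in hx.
- by move=> /andP[hs _] _ _ hy [e _]; rewrite -e hs in hy.
- move=> /andP[_ ha] /andP[_ hb] hx hy [-> e].
  by have [-> -> ->] := IH b ha hb hx hy e.
Qed.

Lemma bin_digits_digits n : all is_digit (bin_digits n).
Proof. by rewrite /bin_digits; case: (bin_of_nat n) => //=; elim. Qed.

Lemma pos_digits_inj p q : pos_digits p = pos_digits q -> p = q.
Proof.
have nil p' : pos_digits p' <> [::] by case: p'.
elim: p q => [p IH|p IH|] [q|q|] //= [].
- by move/IH ->.
- by move/nil.
- by move/IH ->.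
- by move/esym/nil.
Qed.

Lemma bin_digits_inj : injective bin_digits.
Proof.
move=> m n; rewrite /bin_digits => e; apply: (can_inj bin_of_natK); move: e.
case: (bin_of_nat m) => [|p]; case: (bin_of_nat n) => [|q] //=.
- by case: q.
- by case: p.
- by move/pos_digits_inj ->.
Qed.

Lemma clause_syms_inj c d u v :
  clause_syms c ++ u = clause_syms d ++ v -> c = d /\ u = v.
Proof.
rewrite /clause_syms -!catA; elim: c d => [|[x b] c IH] [|[y b'] d] /=.
- by case.
- by case: b'.
- by case: b.
- rewrite -!catA => -[eb e].
  have := @cat_digits_inj _ _ SComma SComma _ _ (bin_digits_digits x) (bin_digits_digits y) isT isT e.
  case=> /bin_digits_inj -> _ /IH[-> ->]; split=> //.
  by congr ((_, _) :: _); move: eb; case: b; case: b'.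
Qed.

(** [REGRES_SIZE] only asserts that some instance has the given code; injectivity identifies it with
    the instance that the reduction has printed. *)
Lemma encode_instance_inj cs k cs' k' :
  encode_instance cs k = encode_instance cs' k' -> cs = cs' /\ k = k'.
Proof.
move/sym_bits_inj => /= e.
have := @cat_digits_inj _ _ SSemi SSemi _ _ (bin_digits_digits k) (bin_digits_digits k') isT isT e.
case=> /bin_digits_inj -> _ {e} e; split=> //.
elim: cs cs' e => [|c cs IH] [|d ds] //=.
- by case: d => [|[y []] d].
- by case: c => [|[y []] c].
- by case/clause_syms_inj => -> /IH ->.
Qed.

(* The number with little-endian binary notation 0^c 1 0^t 1 0^i 1. *)
Definition var_num (c t i : nat) : nat :=
  nat_of_bin (Npos (iter c xO (xI (iter t xO (xI (iter i xO xH)))))).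

Lemma pos_digits_iter n p : pos_digits (iter n xO p) = nseq n S0 ++ pos_digits p.
Proof. by elim: n => //= n ->. Qed.

Lemma var_num_digits c t i :
  bin_digits (var_num c t i) =
  nseq c S0 ++ S1 :: nseq t S0 ++ S1 :: nseq i S0 ++ [:: S1].
Proof.
by rewrite /bin_digits /var_num nat_of_binK; do 3! rewrite /= ?pos_digits_iter.
Qed.

Lemma nseq_inj a b u v :
  nseq a S0 ++ S1 :: u = nseq b S0 ++ S1 :: v -> a = b /\ u = v.
Proof. by elim: a b => [|a IH] [|b] //= [] // /IH[-> ->]. Qed.

Lemma var_num_inj c t i c' t' i' :
  var_num c t i = var_num c' t' i' -> [/\ c = c', t = t' & i = i'].
Proof.
move/(congr1 bin_digits); rewrite !var_num_digits.
by case/nseq_inj => -> /nseq_inj[-> /nseq_inj[-> _]].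
Qed.

Lemma exp2_digits k : bin_digits (2 ^ k) = nseq k S0 ++ [:: S1].
Proof.
have -> : 2 ^ k = nat_of_bin (Npos (iter k xO xH)).
  by elim: k => //= k; rewrite expnS mul2n NatTrec.doubleE => ->.
by rewrite /bin_digits nat_of_binK /= pos_digits_iter.
Qed.

(** * The tableau *)

(* A literal template (s, c, (b, dt), (b', di)): at the time-position pair
   (t, i) it stands for the literal of sign s on the variable with code c, time
   dt (+ t if b) and position di (+ i if b'). *)
Definition tlit := (bool * nat * (bool * nat) * (bool * nat))%type.

Definition coord (x : bool * nat) (t : nat) : nat := (if x.1 then t else 0) + x.2.

Definition inst (t i : nat) (l : tlit) : lit :=
  let: (s, c, x, y) := l in (var_num c (coord x t) (coord y i), s).

Definition tclause := seq tlit.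

Definition tableau_cnf (T : nat -> seq tclause) (z : seq nat) : seq (seq lit) :=
  flatten [seq flatten [seq map (map (inst t i)) (T (nth 0 z i))
                       | i <- iota 0 (size z)]
          | t <- iota 0 (size z)].

Definition tlit_true (al : nat -> nat -> nat -> bool) (t i : nat) (l : tlit) : bool :=
  let: (s, c, x, y) := l in al c (coord x t) (coord y i) == s.

Definition tableau_sat (T : nat -> seq tclause) (z : seq nat) al : Prop :=
  forall t i, t < size z -> i < size z ->
  forall c, c \in T (nth 0 z i) -> has (tlit_true al t i) c.

(** Since [var_num] is injective, any truth values for triples (code, time, position) come from an
    assignment to the numbered variables. *)
Lemma tableau_cnf_sat T z :
  (exists al, satisfies al (tableau_cnf T z)) <-> (exists al, tableau_sat T z al).
Proof.
split=> -[al H].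
  exists (fun c t i => al (var_num c t i)) => t i ht hi c hc.
  have [|l /mapP[l' hl' ->] e] := H (map (inst t i) c).
    apply/flatten_mapP; exists t; first by rewrite mem_iota.
    apply/flatten_mapP; exists i; first by rewrite mem_iota.
    exact: map_f.
  apply/hasP; exists l' => //; move: e.
  by case: l' {hl'} => [[[s k] x] y] /= ->.
pose bt v := decide (exists x : nat * nat * nat,
  v = var_num x.1.1 x.1.2 x.2 /\ al x.1.1 x.1.2 x.2).
have btE c t i : bt (var_num c t i) = al c t i.
  apply/decideP/idP => [[[[c' t'] i'] /= [e h]]|h]; last by exists (c, t, i).
  by case: (var_num_inj e) => -> -> ->.
exists bt => c /flatten_mapP[t]; rewrite mem_iota => /andP[_ ht].
case/flatten_mapP=> i; rewrite mem_iota => /andP[_ hi] /mapP[c' hc' ->].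
have /hasP[l hl e] := H t i ht hi c' hc'; exists (inst t i l); first exact: map_f.
by move: e; case: l {hl} => [[[s k] x] y] /= /eqP; rewrite btE.
Qed.

Definition cells : seq cell := [:: None; Some false; Some true].

Lemma mem_cells a : a \in cells.
Proof. by case: a => [[]|]. Qed.

Definition cell_code (a : cell) : nat :=
  match a with None => 0 | Some false => 1 | Some true => 2 end.

Lemma cell_code_inj : injective cell_code.
Proof. by case=> [[]|] [[]|]. Qed.

Lemma cell_code_lt a : cell_code a < 3.
Proof. by case: a => [[]|]. Qed.

(* Writing the input one cell to the right of the head makes all its letters
   cells of the right half tape; the new start state [None] moves onto it. *)
Definition shift_tm (M : TM) : TM :=
  {| tm_Q := option (tm_Q M);
     tm_start := None;
     tm_halt := fun q => if q is Some q' then tm_halt M q' else false;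
     tm_delta := fun q a => match q with
       | None => (Some (tm_start M), None, MRight)
       | Some q' => let: (q1, b, m) := tm_delta M q' a in (Some q1, b, m)
       end |}.

Section Tableau.
Variable M : TM.
Local Notation N := (shift_tm M).
Local Notation Q := (tm_Q N).

(* the variables of code c at time t and position i say: cell i to the right
   (c < 3), resp. left (c < 6), of the head contains a given letter; the state
   and the scanned letter are given ones (6 <= c, with i = 0) *)
Definition right_code (a : cell) := cell_code a.
Definition left_code (a : cell) := 3 + cell_code a.
Definition head_code (q : Q) (a : cell) := 6 + 3 * enum_rank q + cell_code a.

Arguments right_code : simpl never.
Arguments left_code : simpl never.
Arguments head_code : simpl never.

Lemma head_code_inj q a q' a' :
  head_code q a = head_code q' a' -> q = q' /\ a = a'.
Proof.
rewrite /head_code => e.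
have ha := cell_code_lt a; have ha' := cell_code_lt a'.
have e1 : enum_rank q = enum_rank q' :> nat by lia.
split; first by apply: enum_rank_inj; apply: val_inj.
by apply: cell_code_inj; lia.
Qed.

Definition now := (true, 0).
Definition next := (true, 1).
Definition origin := (false, 0).

Lemma coord_now t : coord now t = t.
Proof. by rewrite /coord addn0. Qed.

Lemma coord_next t : coord next t = t.+1.
Proof. by rewrite /coord addn1. Qed.

(** Halted configurations are repeated, so every row of the tableau is constrained whatever the
    running time. *)
Definition step_of (q : Q) (a : cell) : Q * cell * move :=
  if tm_halt N q then (q, a, MStay) else tm_delta N q a.

(** The guard [nS] confines each clause to one state and scanned letter. The rest is an implication
    from a cell at time [t] to the same cell at time [t + 1], reindexed by the move; extra true
    facts do no harm, as only the facts of the run have to be forced. *)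
Definition step_clauses (q : Q) (a : cell) : seq tclause :=
  let nS : tlit := (false, head_code q a, now, origin) in
  let: (q', b, m) := step_of q a in
  let pS s : tlit := (true, head_code q' s, next, origin) in
  let copy c s x y : tclause :=
    [:: nS; (false, c s, now, x); (true, c s, next, y)] in
  match m with
  | MStay => [:: nS; pS b] ::
      flatten [seq [:: copy left_code s now now; copy right_code s now now]
              | s <- cells]
  | MRight => [:: nS; (true, left_code b, next, origin)] ::
      flatten [seq [:: [:: nS; (false, right_code s, now, origin); pS s];
                       copy left_code s now next; copy right_code s next now]
              | s <- cells]
  | MLeft => [:: nS; (true, right_code b, next, origin)] ::
      flatten [seq [:: [:: nS; (false, left_code s, now, origin); pS s];
                       copy left_code s next now; copy right_code s now next]
              | s <- cells]
  end.

(** The output is the single bit 1 exactly when 1 is scanned and the cell to its right is blank; a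
    halting state with anything else is forbidden. *)
Definition accept_clauses (q : Q) (a : cell) : seq tclause :=
  let nS : tlit := (false, head_code q a, now, origin) in
  if ~~ tm_halt N q then [::]
  else if a == Some true then
    [seq [:: nS; (false, right_code (Some b), now, origin)] | b <- [:: false; true]]
  else [:: [:: nS]].

(* letters of the description of the input: 0 and 1 are bits, 3 is a position
   of the certificate and 4 is a blank *)
Definition init_clauses (a : nat) : seq tclause :=
  let pR s x : tlit := (true, right_code s, origin, x) in
  [:: [:: (true, head_code (tm_start N) None, origin, origin)];
      [:: (true, left_code None, origin, now)]] ++
  match a with
  | 0 => [:: [:: pR (Some false) now]]
  | 1 => [:: [:: pR (Some true) now]]
  | 3 => [:: [:: pR None now; pR (Some false) now; pR (Some true) now];
             [:: (false, right_code None, origin, now); pR None next]]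
  | 4 => [:: [:: pR None now]]
  | _ => [::]
  end.

(** Only the initial row depends on the letter. Its clauses fix the time at [origin], so emitting
    them for every [t] merely repeats them, and one double loop prints the whole formula. *)
Definition templates (a : nat) : seq tclause :=
  init_clauses a ++
  flatten [seq flatten [seq step_clauses q s ++ accept_clauses q s | s <- cells]
          | q <- enum Q].

Lemma templates_init a c : c \in init_clauses a -> c \in templates a.
Proof. by move=> h; rewrite mem_cat h. Qed.

Lemma templates_step a q s c : c \in step_clauses q s -> c \in templates a.
Proof.
move=> h; rewrite mem_cat; apply/orP; right; apply/flatten_mapP; exists q.
  by rewrite mem_enum.
by apply/flatten_mapP; exists s; rewrite ?mem_cells // mem_cat h.
Qed.

Lemma templates_accept a q s c : c \in accept_clauses q s -> c \in templates a.
Proof.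
move=> h; rewrite mem_cat; apply/orP; right; apply/flatten_mapP; exists q.
  by rewrite mem_enum.
by apply/flatten_mapP; exists s; rewrite ?mem_cells // mem_cat h orbT.
Qed.

Definition conf (w : seq bool) (t : nat) : Q * tape :=
  iter t (sstep N) (None, (fun=> None, None, nth None (map Some w))).

Lemma sstep_step_of q l a r :
  sstep N (q, (l, a, r)) =
  let: (q', b, m) := step_of q a in (q', tact b m (l, a, r)).
Proof. by rewrite /sstep /step_of; case: ifP. Qed.

(** The first step of the shifted machine only moves onto the input; hence its time runs one ahead
    of that of [M]. *)
Lemma conf_run w t :
  conf w t.+1 = let: (q, T) := sconf (iter t (tm_step M) (tm_init M w)) in (Some q, T).
Proof.
elim: t => [|t IH].
  rewrite /conf /= /scanned /=; case: w => [|b w] /=.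
    by congr (_, (_, _, _)); apply: functional_extensionality; case.
  by congr (_, (_, _, _)); apply: functional_extensionality; case=> // -[].
rewrite [conf w t.+2]/(sstep N (conf w t.+1)) IH iterS sconf_step.
case: (sconf _) => q T; rewrite /sstep /=; case: (tm_halt M q) => //.
by case: (tm_delta M q _) => [[q' b] m].
Qed.

Definition accepting (c : Q * tape) : bool :=
  let: (q, (l, a, r)) := c in [&& tm_halt N q, a == Some true & r 0 == None].

Lemma accepting_output w t :
  accepting (conf w t.+1) <->
  tm_halted (iter t (tm_step M) (tm_init M w)) /\
  tm_output (iter t (tm_step M) (tm_init M w)) = [:: true].
Proof.
rewrite conf_run; case: (iter t _ _) => [[[q l] a] r] /=.
split=> [/and3P[-> /eqP -> /eqP hr]|[-> h]]; first by split=> //; case: r hr => [|[]].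
by case: a h => [[]|] //; case: r => [|[x|] r].
Qed.

Lemma conf_halted w t t' :
  t <= t' -> tm_halt N (conf w t).1 -> conf w t' = conf w t.
Proof.
move=> le_t; rewrite -(subnK le_t) /conf iterD.
by case: (iter t _ _) => q T h; rewrite sstep_halted.
Qed.

Section Completeness.
Variables (w : seq bool) (z : seq nat) (T0 : nat).
Hypothesis z_bit : forall i b, i < size z -> nth 0 z i = nat_of_bool b ->
  nth None (map Some w) i = Some b.
Hypothesis z_blank : forall i, i < size z -> nth 0 z i = 4 ->
  nth None (map Some w) i = None.
Hypothesis w_accepted : accepting (conf w T0).

Definition fact (c t i : nat) : bool :=
  let: (q, (l, a, r)) := conf w t in
  if c < 3 then right_code (r i) == c
  else if c < 6 then left_code (l i) == c
  else head_code q a == c.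

Lemma fact_right a t i : fact (right_code a) t i = ((conf w t).2.2 i == a).
Proof.
rewrite /fact; case: (conf w t) => q [[l b] r]; rewrite cell_code_lt.
by rewrite (inj_eq cell_code_inj).
Qed.

Lemma fact_left a t i : fact (left_code a) t i = ((conf w t).2.1.1 i == a).
Proof.
rewrite /fact; case: (conf w t) => q [[l b] r] /=.
have ha := cell_code_lt a; rewrite /left_code; case_ifs.
by rewrite eqn_add2l (inj_eq cell_code_inj).
Qed.

Lemma fact_head q a t i :
  fact (head_code q a) t i = ((conf w t).1 == q) && ((conf w t).2.1.2 == a).
Proof.
rewrite /fact; case: (conf w t) => q' [[l b] r] /=.
apply/eqP/andP => [/head_code_inj[-> ->]|[/eqP -> /eqP ->]] //.
Qed.

Lemma tableau_complete : tableau_sat templates z fact.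
Proof.
move=> t i ht hi c; rewrite mem_cat; case/orP.
  have hw b : nth 0 z i = nat_of_bool b -> nth None (map Some w) i = Some b.
    exact: z_bit.
  rewrite mem_cat; case/orP.
    by rewrite !inE; case/orP=> /eqP -> /=; rewrite ?fact_head ?fact_left /=.
  have := z_blank hi; case: (nth 0 z i) hw => [|[|[|[|[|a]]]]] // hw hb.
  - by rewrite inE => /eqP -> /=; rewrite fact_right /coord /= addn0 (hw false).
  - by rewrite inE => /eqP -> /=; rewrite fact_right /coord /= addn0 (hw true).
  - rewrite !inE; case/orP=> /eqP -> /=; rewrite !fact_right /coord /= ?addn0 ?addn1.
      by case: (nth None _ _) => [[]|].
    (* A word has no gaps: a blank in cell [i] means that [w] has ended, so cell [i.+1] is blank
       too. *)
    case: (leqP (size w) i) => hwi; last by rewrite (nth_map false).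
    by rewrite [nth None _ i.+1]nth_default ?size_map ?orbT // ltnW.
  - by rewrite inE => /eqP -> /=; rewrite fact_right /coord /= addn0 hb.
case/flatten_mapP=> q _ /flatten_mapP[s _]; rewrite mem_cat.
(* A guarded clause needs checking only when the run is in state [q] scanning [s] at time [t]. *)
have hS : ~~ tlit_true fact t i (false, head_code q s, now, origin) ->
    exists l r, conf w t = (q, (l, s, r)).
  rewrite /= fact_head /coord /= addn0.
  case: (conf w t) => q' [[l a] r] /=; case: andP => // -[/eqP -> /eqP ->] _.
  by exists l, r.
case/orP.
- rewrite /step_clauses; case e: (step_of q s) => [[q' b] m].
  set nS : tlit := (false, head_code q s, now, origin) in hS *.
  have hcons c' : c = nS :: c' ->
     (forall l r, conf w t = (q, (l, s, r)) -> conf w t.+1 = (q', tact b m (l, s, r)) ->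
        has (tlit_true fact t i) c') -> has (tlit_true fact t i) c.
    move=> -> h; rewrite /has -/has; case: (boolP (tlit_true _ _ _ nS)) => //.
    case/hS=> l [r hc]; apply: (h l r) => //.
    by rewrite /conf iterS -/(conf w t) hc sstep_step_of e.
  case: m e hcons => e hcons; rewrite inE; case/orP.
  + move/eqP/hcons; apply=> l r h1 h2 /=.
    by rewrite fact_right /coord /= addn1 h2 /= eqxx.
  + case/flatten_mapP=> u _; rewrite !inE; case/or3P=> /eqP/hcons; apply=> l r h1 h2 /=;
    rewrite /coord /= ?fact_right ?fact_left ?fact_head ?addn0 ?addn1 h2 ?h1 /= ?eqxx //;
    rewrite /stail; by case: (_ == u).
  + move/eqP/hcons; apply=> l r h1 h2 /=.
    by rewrite fact_left /coord /= addn1 h2 /= eqxx.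
  + case/flatten_mapP=> u _; rewrite !inE; case/or3P=> /eqP/hcons; apply=> l r h1 h2 /=;
    rewrite /coord /= ?fact_right ?fact_left ?fact_head ?addn0 ?addn1 h2 ?h1 /= ?eqxx //;
    rewrite /stail; by case: (_ == u).
  + move/eqP/hcons; apply=> l r h1 h2 /=.
    by rewrite fact_head /coord /= addn1 h2 /= !eqxx.
  + case/flatten_mapP=> u _; rewrite !inE; case/orP=> /eqP/hcons; apply=> l r h1 h2 /=;
    rewrite /coord /= ?fact_right ?fact_left ?fact_head ?addn0 ?addn1 h2 ?h1 /= ?eqxx //;
    rewrite /stail; by case: (_ == u).
rewrite /accept_clauses; case: (boolP (tm_halt N q)) => //= hq.
(* Halted configurations persist, so one halted at time [t] equals the accepting one at [T0], in
   whichever order the two times come. *)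
have key l r : conf w t = (q, (l, s, r)) -> s = Some true /\ r 0 = None.
  move=> hc; have e : conf w t = conf w T0.
    case: (leqP t T0) => h; first by rewrite (conf_halted h) // hc.
    rewrite (conf_halted (ltnW h)) //; move: w_accepted.
    by case: (conf w T0) => q' [[l' a'] r'] /and3P[].
  by move: w_accepted; rewrite -e hc => /and3P[_ /eqP-> /eqP->].
case: eqP => hs.
  by rewrite !inE; case/orP=> /eqP -> ; rewrite [has _ _]/(_ || (_ || _));
    case: (boolP (tlit_true _ _ _ _)) => //= /hS[l [r hc]];
    rewrite fact_right /coord /= addn0 hc /=; have [_ ->] := key _ _ hc.
rewrite inE => /eqP -> ; rewrite /has.
by case: (boolP (tlit_true _ _ _ _)) => //= /hS[l [r hc]]; have [] := key _ _ hc.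
Qed.

End Completeness.

Section Soundness.
Variables (p : seq bool) (k : nat) (z : seq nat) (al : nat -> nat -> nat -> bool).
Hypothesis z_size : size p + k <= size z.
Hypothesis z_pos : 0 < size z.
Hypothesis z_bit : forall i, i < size p -> nth 0 z i = nat_of_bool (nth false p i).
Hypothesis z_cert : forall i, i < k -> nth 0 z (size p + i) = 3.
Hypothesis z_blank : forall i, size p + k <= i < size z -> nth 0 z i = 4.
Hypothesis sat : tableau_sat templates z al.

Lemma sat_init i c : i < size z -> c \in init_clauses (nth 0 z i) ->
  has (tlit_true al 0 i) c.
Proof. by move=> hi /templates_init; apply: sat. Qed.

Let blank i := al (right_code None) 0 (size p + i).
(** The certificate ends at the first position that the assignment declares blank. A cell may be
    assigned several letters; 1 is preferred over 0. *)
Let cert : seq bool :=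
  mkseq (fun i => al (right_code (Some true)) 0 (size p + i)) (find blank (iota 0 k)).

Lemma cert_size : size cert <= k.
Proof. by rewrite size_mkseq -{2}(size_iota 0 k) find_size. Qed.

(** The second clause for letter 3 propagates blanks to the right, so the certificate area holds
    bits followed by blanks only. *)
Lemma blank_after j : size cert <= j < k -> blank j.
Proof.
rewrite size_mkseq; set f := find _ _ => /andP[hf hj].
have hf' : f < k by apply: leq_ltn_trans hj.
have : blank f.
  have := @nth_find _ 0 blank (iota 0 k); rewrite has_find size_iota => /(_ hf').
  by rewrite nth_iota.
have [d ed] : exists d, j = f + d by exists (j - f); rewrite subnKC.
rewrite ed in hj *; clear j ed hf; elim: d hj => [|d IH] h hb; first by rewrite addn0.
rewrite addnS in h *; have {IH}hb := IH (ltnW h) hb.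
have hi : size p + (f + d) < size z by lia.
have := @sat_init _ [:: (false, right_code None, origin, now);
                        (true, right_code None, origin, next)] hi.
rewrite z_cert; last by lia.
rewrite !inE eqxx orbT => /(_ isT) /=; rewrite /coord /= !addn0 addn1 orbF.
move: hb; rewrite /blank => -> /=; rewrite eqb_id.
by rewrite addnS.
Qed.

Lemma sat_right0 j : j < size z ->
  al (right_code (nth None (map Some (p ++ cert)) j)) 0 j.
Proof.
move=> hj; rewrite map_cat nth_cat size_map; case: ltnP => hjp.
  rewrite (nth_map false) //; have := z_bit hjp; case: (nth false p j) => e.
    have := @sat_init _ [:: (true, right_code (Some true), origin, now)] hj.
    by rewrite e mem_cat mem_head orbT => /(_ isT) /=; rewrite /coord /= !addn0 orbF eqb_id.
  have := @sat_init _ [:: (true, right_code (Some false), origin, now)] hj.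
  by rewrite e mem_cat mem_head orbT => /(_ isT) /=; rewrite /coord /= !addn0 orbF eqb_id.
case: (ltnP (j - size p) k) => hjk; last first.
  rewrite nth_default; last by rewrite size_map (leq_trans cert_size).
  have := @sat_init _ [:: (true, right_code None, origin, now)] hj.
  rewrite z_blank; last by lia.
  by rewrite mem_cat mem_head orbT => /(_ isT) /=; rewrite /coord /= !addn0 orbF eqb_id.
have ej : size p + (j - size p) = j by lia.
case: (ltnP (j - size p) (size cert)) => hjc; last first.
  rewrite nth_default ?(size_map Some) //.
  by have := @blank_after (j - size p); rewrite /blank ej => -> //; rewrite hjc.
rewrite (nth_map false) // nth_mkseq; last by rewrite size_mkseq in hjc.
(* When 1 is not asserted, blank is excluded as well, because the position precedes the first blank;
   the three-way clause then forces 0. *)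
rewrite ej; case et: (al (right_code (Some true)) 0 j) => //.
have nb : blank (j - size p) = false.
  have := @before_find _ 0 blank (iota 0 k) (j - size p).
  by rewrite size_mkseq in hjc; rewrite nth_iota // => /(_ hjc).
have := @sat_init _ [:: (true, right_code None, origin, now);
  (true, right_code (Some false), origin, now);
  (true, right_code (Some true), origin, now)] hj.
rewrite -{1}ej z_cert // !inE eqxx => /(_ isT) /=; rewrite /coord /= !addn0 et.
by move: nb; rewrite /blank ej => -> /=; rewrite orbF eqb_id.
Qed.

(* Row t of the tableau has no clause for the cells entering at its ends, so the
   clauses determine only the cells with t + i < size z. *)
Lemma sat_conf t : t < size z ->
  let: (q, (l, a, r)) := conf (p ++ cert) t in
  al (head_code q a) t 0 /\
  forall i, t + i < size z -> al (left_code (l i)) t i /\ al (right_code (r i)) t i.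
Proof.
elim: t => [|t IH] ht.
  rewrite /conf /=; split.
    have := @sat_init 0 [:: (true, head_code (tm_start N) None, origin, origin)] z_pos.
    by rewrite mem_cat inE eqxx => /(_ isT) /=; rewrite /coord /= orbF eqb_id.
  move=> i hi; split; last exact: sat_right0.
  have := @sat_init i [:: (true, left_code None, origin, now)] hi.
  by rewrite mem_cat !inE eqxx orbT => /(_ isT) /=; rewrite /coord /= !addn0 orbF eqb_id.
have {IH} := IH (ltnW ht).
have -> : conf (p ++ cert) t.+1 = sstep N (conf (p ++ cert) t) by [].
case: (conf _ t) => q [[l a] r] [hS hI].
rewrite sstep_step_of; case e: (step_of q a) => [[q' b] m].
have use i c : i < size z ->
    (false, head_code q a, now, origin) :: c \in step_clauses q a ->
    has (tlit_true al t i) c.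
  move=> hi /(templates_step (nth 0 z i)) hc; have := sat (ltnW ht) hi hc.
  by rewrite /= /coord /= addn0 hS.
have copyP (cd : cell -> nat) s x y i : i < size z ->
    [:: (false, head_code q a, now, origin); (false, cd s, now, x); (true, cd s, next, y)]
      \in step_clauses q a ->
    al (cd s) t (coord x i) -> al (cd s) t.+1 (coord y i).
  move=> hi /(use _ _ hi) /=; rewrite /coord /= addn0 addn1 orbF.
  by move=> h h1; move: h; rewrite h1 eqb_id.
have mem2 (g : cell -> seq tclause) h c s : c \in g s -> c \in h :: flatten [seq g s | s <- cells].
  move=> hc; rewrite inE; apply/orP; right; apply/flatten_mapP; exists s => //.
  exact: mem_cells.
move: use copyP; rewrite /step_clauses e; case: m e => e use copyP /=; split.
(* For each move the new head fact comes first, then the cells: cell 0 on the side the head leaves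
   behind gets the written letter, and all others are copied. *)
- have := @use 0 _ z_pos (mem2 _ _ _ (l 0) (mem_head _ _)).
  rewrite /= /coord /= !addn0 addn1 orbF; have [|-> _] := hI 0; first by lia.
  by rewrite eqb_id.
- move=> i hi; split.
    have [|h _] := hI i.+1; first by lia.
    have := @copyP left_code (l i.+1) next now i; rewrite ?coord_now ?coord_next.
    by apply=> //; try lia; apply: (mem2 _ _ _ (l i.+1)); rewrite !inE eqxx !orbT.
  case: i hi => [|i] hi /=.
    have := use 0 _ z_pos (mem_head _ _).
    by rewrite /= /coord /= addn1 orbF eqb_id.
  have [|_ h] := hI i; first by lia.
  have := @copyP right_code (r i) now next i; rewrite ?coord_now ?coord_next.
  by apply=> //; try lia; apply: (mem2 _ _ _ (r i)); rewrite !inE eqxx !orbT.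
- have := @use 0 _ z_pos (mem2 _ _ _ (r 0) (mem_head _ _)).
  rewrite /= /coord /= !addn0 addn1 orbF; have [|_ ->] := hI 0; first by lia.
  by rewrite eqb_id.
- move=> i hi; split; last first.
    have [|_ h] := hI i.+1; first by lia.
    have := @copyP right_code (r i.+1) next now i; rewrite ?coord_now ?coord_next.
    by apply=> //; try lia; apply: (mem2 _ _ _ (r i.+1)); rewrite !inE eqxx !orbT.
  case: i hi => [|i] hi /=.
    have := use 0 _ z_pos (mem_head _ _).
    by rewrite /= /coord /= addn1 orbF eqb_id.
  have [|h _] := hI i; first by lia.
  have := @copyP left_code (l i) now next i; rewrite ?coord_now ?coord_next.
  by apply=> //; try lia; apply: (mem2 _ _ _ (l i)); rewrite !inE eqxx !orbT.
- have := use 0 _ z_pos (mem_head _ _).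
  by rewrite /= /coord /= addn1 orbF eqb_id.
- move=> i hi; have [|h1 h2] := hI i; first by lia.
  split.
    have := @copyP left_code (l i) now now i; rewrite ?coord_now ?coord_next.
    by apply=> //; try lia; apply: (mem2 _ _ _ (l i)); rewrite !inE eqxx.
  have := @copyP right_code (r i) now now i; rewrite ?coord_now ?coord_next.
  by apply=> //; try lia; apply: (mem2 _ _ _ (r i)); rewrite !inE eqxx !orbT.
Qed.

Lemma sat_accepting t : t < size z -> tm_halt N (conf (p ++ cert) t).1 ->
  accepting (conf (p ++ cert) t).
Proof.
move=> ht; have := sat_conf ht; case: (conf _ t) => q [[l a] r] [hS hI].
rewrite [(_, _).1]/= => hq; rewrite /accepting hq [true && _]/=.
have use c : (false, head_code q a, now, origin) :: c \in accept_clauses q a ->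
    has (tlit_true al t 0) c.
  move=> /(templates_accept (nth 0 z 0)) hc; have := sat ht z_pos hc.
  by rewrite /= /coord /= addn0 hS.
move: use; rewrite /accept_clauses hq [~~ _]/=; case: eqP => [_|_] use; last first.
  by have := use [::] (mem_head _ _).
have [|_ hr] := hI 0; first by rewrite addn0.
case er: (r 0) hr => [b|] // hr.
have := use [:: (false, right_code (Some b), now, origin)].
rewrite !inE /= /coord /= !addn0 orbF hr => h.
by case: b {er hr} h => h; have := h _; rewrite eqxx ?orbT => /(_ isT).
Qed.

(** The certificate is read off row 0 once, so a single [y] serves all times; that a halting time
    below [size z] exists is supplied later by the bound on the verifier. *)
Lemma tableau_sound : exists2 y, size y <= k &
  forall t, t < size z -> tm_halt N (conf (p ++ y) t).1 ->
  accepting (conf (p ++ y) t).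
Proof. by exists cert; [exact: cert_size | exact: sat_accepting]. Qed.

End Soundness.
End Tableau.

(** * Computing the reduction *)

Definition fseq (ps : seq fprog) : fprog := foldr FSeq FSkip ps.

Lemma den_fseq d ps s env :
  den d (fseq ps) s env = flatten [seq den d p s env | p <- ps].
Proof. by elim: ps => //= p ps ->. Qed.

Lemma wf_fseq d ps : wf d (fseq ps) = all (wf d) ps.
Proof. by elim: ps => //= p ps ->. Qed.

Lemma wf_for d p : wf d (FFor p) = (d < 3) && wf d.+1 p.
Proof. by []. Qed.

Lemma wf_test d v k p q :
  wf d (FTest v k p q) = [&& v < d, v < 3, k < 8, wf d p & wf d q].
Proof. by []. Qed.

Lemma wf_seq d p q : wf d (FSeq p q) = wf d p && wf d q.
Proof. by []. Qed.

Lemma den_for d p s env : den d (FFor p) s env =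
  flatten [seq den d.+1 p s (set_env env d i) | i <- iota 0 (size s)].
Proof. by []. Qed.

Lemma den_test d v k p q s env : den d (FTest v k p q) s env =
  if bit_at s env (env v) k then den d p s env else den d q s env.
Proof. by []. Qed.

Lemma den_seq d p q s env : den d (FSeq p q) s env = den d p s env ++ den d q s env.
Proof. by []. Qed.

Definition emit_bits (bs : seq bool) : fprog := fseq (map FEmit bs).

Arguments emit_bits : simpl never.

Lemma den_emit_bits d bs s env : den d (emit_bits bs) s env = bs.
Proof. by rewrite den_fseq -map_comp /=; elim: bs => //= b bs ->. Qed.

Lemma wf_emit_bits d bs : wf d (emit_bits bs).
Proof. by rewrite wf_fseq all_map; apply/allP. Qed.

(** Of the 8 bits in a block, three are loop marks; the other five encode the letters 0 to 4 in
    unary. *)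
Definition fswitch (v : nat) (g : nat -> fprog) : fprog :=
  foldr (fun a q => FTest v (3 + a) (g a) q) FSkip (iota 0 5).

Arguments fswitch : simpl never.

Lemma den_fswitch d v g s env : nth 0 s (env v) < 5 ->
  den d (fswitch v g) s env = den d (g (nth 0 s (env v))) s env.
Proof.
by rewrite /fswitch /= /bit_at /=; case: (nth 0 s (env v)) => [|[|[|[|[|a]]]]].
Qed.

Lemma wf_fswitch d v g :
  v < d -> v < 3 -> (forall a, a < 5 -> wf d (g a)) -> wf d (fswitch v g).
Proof. by move=> h1 h2 h; rewrite /fswitch /= h1 h2 !h. Qed.

Definition letters (s : seq nat) : bool := all (fun a => a < 5) s.

Lemma nth_letters s i : letters s -> i < size s -> nth 0 s i < 5.
Proof. by move=> /all_nthP; apply. Qed.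

Lemma den_for_switch d g (h : nat -> seq bool) s env : letters s ->
  (forall a i, a < 5 -> i < size s -> den d.+1 (g a) s (set_env env d i) = h a) ->
  den d (FFor (fswitch d g)) s env = flatten (map h s).
Proof.
move=> hs H; rewrite -[in RHS](mkseq_nth 0 s) /mkseq -map_comp.
rewrite den_for; congr flatten.
apply/eq_in_map => i; rewrite mem_iota => /andP[_ hi]; rewrite den_fswitch.
  by rewrite set_env_eq H // nth_letters.
by rewrite set_env_eq nth_letters.
Qed.

Lemma enc_cat s1 s2 : enc (s1 ++ s2) = enc s1 ++ enc s2.
Proof. by rewrite /enc map_cat flatten_cat. Qed.

Lemma enc_flatten (h : nat -> seq nat) s :
  enc (flatten (map h s)) = flatten (map (enc \o h) s).
Proof. by elim: s => //= a s IH; rewrite enc_cat IH. Qed.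

Lemma poly_computes_ext X (u v w : X -> seq bool) :
  poly_computes u v -> (forall x, v x = w x) -> poly_computes u w.
Proof.
by move=> [p [a H]] e; exists p, a => x; rewrite -e.
Qed.

Lemma letters_bits (x : seq bool) : letters (map nat_of_bool x).
Proof. by apply/allP => a /mapP[b _ ->]; case: b. Qed.

Lemma subst_poly_computes X (u : X -> seq nat) (h : nat -> seq nat) w :
  (forall x, letters (u x)) ->
  poly_computes (fun x => enc (u x)) (fun x => enc (flatten (map h (u x)) ++ w)).
Proof.
move=> hu; pose p := FSeq (FFor (fswitch 0 (fun a => emit_bits (enc (h a)))))
                          (emit_bits (enc w)).
apply: poly_computes_ext (@fprog_poly_computes _ u p _) _.
  by rewrite wf_seq wf_for wf_emit_bits wf_fswitch // => a _; apply: wf_emit_bits.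
move=> x; rewrite den_seq den_emit_bits enc_cat enc_flatten; congr (_ ++ _).
by apply: den_for_switch => // a i _ _; rewrite den_emit_bits.
Qed.

(** If [sel] does not count [a0], each pass multiplies the number of letters [a0] by a fixed count;
    repeated passes produce the powers in polynomial bounds. *)
Lemma square_poly_computes X (u : X -> seq nat) (a0 : nat) (sel : pred nat) :
  (forall x, letters (u x)) ->
  poly_computes (fun x => enc (u x))
    (fun x => enc (flatten [seq if a == a0 then nseq (count sel (u x)) a else [:: a]
                           | a <- u x])).
Proof.
move=> hu.
pose inner a := FFor (fswitch 1 (fun b => if sel b then emit_bits (enc [:: a]) else FSkip)).
pose p := FFor (fswitch 0 (fun a => if a == a0 then inner a else emit_bits (enc [:: a]))).
apply: poly_computes_ext (@fprog_poly_computes _ u p _) _.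
  rewrite wf_for wf_fswitch // => a _; case: ifP => _; last exact: wf_emit_bits.
  by rewrite wf_for wf_fswitch // => b _; case: ifP => _ //; exact: wf_emit_bits.
move=> x; rewrite (enc_flatten (fun a => if a == a0 then _ else _)).
apply: den_for_switch => // a i _ hi; rewrite /comp; case: ifP => _.
  2: by rewrite den_emit_bits.
rewrite (@den_for_switch 1 _ (fun b => if sel b then enc [:: a] else [::])) //.
  elim: (u x) => // b s IH; rewrite [count _ _]/(sel b + count sel s) nseqD enc_cat -IH.
  by rewrite map_cons; case: (sel b).
by move=> b j _ _; case: ifP => _ //; rewrite den_emit_bits.
Qed.

(** The marks compare loop positions: bit [v] of block [j] is set exactly when [j] is below variable
    [v], so a third loop prints that many zeros. *)
Definition unary (v : nat) : fprog := FFor (FTest 2 v (emit_bits (sym_bits S0)) FSkip).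

Definition syms_bits (ss : seq sym) : seq bool := flatten (map sym_bits ss).

Lemma syms_bits_cat s1 s2 : syms_bits (s1 ++ s2) = syms_bits s1 ++ syms_bits s2.
Proof. by rewrite /syms_bits map_cat flatten_cat. Qed.

Lemma syms_bits_flatten ss : syms_bits (flatten ss) = flatten (map syms_bits ss).
Proof. by elim: ss => //= s ss IH; rewrite syms_bits_cat IH. Qed.

Lemma flatten_below (T : Type) (b : seq T) n m : n <= m ->
  flatten [seq (if j < n then b else [::]) | j <- iota 0 m] = flatten (nseq n b).
Proof.
move=> le_nm; have key k : flatten [seq (if j < n then b else [::]) | j <- iota 0 k]
                         = flatten (nseq (minn n k) b).
  elim: k => [|k IH]; first by rewrite minn0.
  rewrite -{1}addn1 iotaD add0n map_cat flatten_cat IH /= cats0.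
  case: ltnP => h; last by rewrite cats0 (minn_idPl (leqW h)).
  rewrite (minn_idPr h) -[in RHS]addn1 nseqD flatten_cat.
  by rewrite /= cats0.
by rewrite key (minn_idPl le_nm).
Qed.

Lemma den_unary v s env : v < 2 -> env v <= size s ->
  den 2 (unary v) s env = syms_bits (nseq (env v) S0).
Proof.
move=> hv he; rewrite /syms_bits map_nseq -(flatten_below _ he) den_for; congr flatten.
apply: eq_map => j; rewrite den_test den_emit_bits.
by rewrite set_env_eq /bit_at (leq_trans hv) // /set_env ltn_eqF.
Qed.

Arguments unary : simpl never.

Definition emit_syms (ss : seq sym) : fprog := emit_bits (syms_bits ss).

Definition emit_coord (x : bool * nat) (v : nat) : fprog :=
  FSeq (if x.1 then unary v else FSkip) (emit_syms (nseq x.2 S0)).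

Definition emit_lit (l : tlit) : fprog :=
  let: (s, c, x, y) := l in
  FSeq (emit_syms ((if s then S1 else S0) :: nseq c S0 ++ [:: S1]))
    (FSeq (emit_coord x 0) (FSeq (emit_syms [:: S1])
      (FSeq (emit_coord y 1) (emit_syms [:: S1; SComma])))).

Definition emit_clause (c : tclause) : fprog :=
  FSeq (fseq (map emit_lit c)) (emit_syms [:: SSemi]).

Lemma den_emit_coord x v s env : v < 2 -> env v <= size s ->
  den 2 (emit_coord x v) s env = syms_bits (nseq (coord x (env v)) S0).
Proof.
case: x => b n hv he; rewrite den_seq den_emit_bits /coord nseqD syms_bits_cat.
by case: b; rewrite ?den_unary.
Qed.

Lemma wf_emit_coord x v : v < 2 -> wf 2 (emit_coord x v).
Proof.
move=> hv; rewrite wf_seq wf_emit_bits andbT; case: x => -[] n //.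
by rewrite wf_for wf_test wf_emit_bits (leq_trans hv).
Qed.

Lemma den_emit_lit l s env : env 0 <= size s -> env 1 <= size s ->
  den 2 (emit_lit l) s env = syms_bits (lit_syms (inst (env 0) (env 1) l)).
Proof.
case: l => [[[b c] x] y] h0 h1; rewrite den_seq den_emit_bits.
rewrite den_seq den_emit_coord // den_seq den_emit_bits den_seq den_emit_coord //.
rewrite den_emit_bits -!syms_bits_cat /lit_syms var_num_digits; congr syms_bits.
by do 3! rewrite -?catA /=.
Qed.

Lemma den_emit_clause c s env : env 0 <= size s -> env 1 <= size s ->
  den 2 (emit_clause c) s env = syms_bits (clause_syms (map (inst (env 0) (env 1)) c)).
Proof.
move=> h0 h1; rewrite den_seq den_emit_bits den_fseq /clause_syms syms_bits_cat.
rewrite syms_bits_flatten -!map_comp; congr (flatten _ ++ _).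
by apply: eq_map => l /=; rewrite den_emit_lit.
Qed.

Lemma wf_emit_clause c : wf 2 (emit_clause c).
Proof.
rewrite wf_seq wf_emit_bits andbT wf_fseq all_map; apply/allP => -[[[b k] x] y] _.
rewrite /preim inE wf_seq wf_emit_bits wf_seq wf_emit_coord // wf_seq wf_emit_bits.
by rewrite wf_seq wf_emit_coord // wf_emit_bits.
Qed.

Lemma size_flatten_le (X : eqType) (Y : Type) (f : X -> seq Y) (s : seq X) B :
  {in s, forall x, size (f x) <= B} -> size (flatten (map f s)) <= size s * B.
Proof.
elim: s => //= x s IH H; rewrite size_cat mulSn leq_add ?H ?mem_head //.
by apply: IH => y hy; apply: H; rewrite inE hy orbT.
Qed.

Lemma flatten_flatten (Y : Type) (s : seq (seq (seq Y))) :
  flatten (flatten s) = flatten (map flatten s).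
Proof. by elim: s => //= x s IH; rewrite flatten_cat IH. Qed.

Lemma flatten_map1 (Y : Type) (s : seq Y) : flatten [seq [:: y] | y <- s] = s.
Proof. by elim: s => //= y s ->. Qed.

Section Emission.
Variable T : nat -> seq tclause.

(** Summing over all five letters bounds the literals of any single position independently of its
    letter, so the exponent depends only on the word length and can be printed by two loops. *)
Definition template_size : nat := \sum_(a < 5) size (flatten (T a)).

Definition size_exponent (m : nat) : nat := m * (m * template_size).

Lemma size_tableau_cnf z : letters z ->
  size (flatten (tableau_cnf T z)) <= size_exponent (size z).
Proof.
move=> hz; rewrite flatten_flatten -map_comp /size_exponent.
rewrite -[X in _ <= X * _](size_iota 0 (size z)).
apply: size_flatten_le => t _ /=; rewrite flatten_flatten -map_comp.
rewrite -[X in _ <= X * _](size_iota 0 (size z)).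
apply: size_flatten_le => i; rewrite mem_iota /= => hi.
rewrite -map_flatten size_map.
have ha := nth_letters hz hi; rewrite /template_size (bigD1 (Ordinal ha)) //=.
exact: leq_addr.
Qed.

Definition tableau_prog : fprog :=
  FSeq (FFor (FFor (emit_syms (nseq template_size S0))))
    (FSeq (emit_syms [:: S1; SSemi])
      (FFor (FFor (fswitch 1 (fun a => fseq (map emit_clause (T a))))))).

Lemma wf_tableau_prog : wf 0 tableau_prog.
Proof.
rewrite wf_seq !wf_for wf_emit_bits wf_seq wf_emit_bits !wf_for wf_fswitch // => a _.
by rewrite wf_fseq all_map; apply/allP => c _; apply: wf_emit_clause.
Qed.

Definition tableau_instance (z : seq nat) : seq bool :=
  encode_instance (tableau_cnf T z) (2 ^ size_exponent (size z)).

Lemma flatten_zeros (X : Type) (s : seq X) a :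
  flatten [seq syms_bits (nseq a S0) | _ <- s] = syms_bits (nseq (size s * a) S0).
Proof. by elim: s => //= x s ->; rewrite mulSn nseqD syms_bits_cat. Qed.

Lemma den_tableau_prog z : letters z -> den 0 tableau_prog z env0 = tableau_instance z.
Proof.
move=> hz; rewrite /tableau_instance /encode_instance -/(syms_bits _) exp2_digits.
rewrite !syms_bits_cat -catA den_seq; congr (_ ++ _).
  rewrite den_for; under eq_map => t.
    rewrite den_for; under eq_map => i do rewrite den_emit_bits.
    rewrite flatten_zeros size_iota; over.
  by rewrite flatten_zeros size_iota.
rewrite den_seq den_emit_bits -[syms_bits [:: S1; SSemi]]/(syms_bits [:: S1] ++ syms_bits [:: SSemi]).
rewrite -catA; congr (_ ++ (_ ++ _)).
rewrite syms_bits_flatten -map_comp /tableau_cnf map_flatten flatten_flatten den_for.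
rewrite -!map_comp; congr flatten; apply/eq_in_map => t; rewrite mem_iota => /andP[_ ht].
rewrite den_for /comp map_flatten flatten_flatten -!map_comp; congr flatten.
apply/eq_in_map => i; rewrite mem_iota => /andP[_ hi].
have e1 : set_env (set_env env0 0 t) 1 i 1 = i by [].
have e0 : set_env (set_env env0 0 t) 1 i 0 = t by [].
rewrite den_fswitch e1 ?nth_letters // den_fseq -map_comp /comp -map_comp; congr flatten.
by apply: eq_map => c; rewrite /comp den_emit_clause ?e0 ?e1 // ltnW.
Qed.

Lemma tableau_instance_poly X (z : X -> seq nat) : (forall x, letters (z x)) ->
  poly_computes (fun x => enc (z x)) (fun x => tableau_instance (z x)).
Proof.
move=> hz; apply: poly_computes_ext (@fprog_poly_computes _ z _ wf_tableau_prog) _.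
by move=> x; apply: den_tableau_prog.
Qed.

End Emission.

(** A refutation excludes satisfying assignments by soundness; conversely the completeness bound
    lies below [2 ^ size_exponent], since the exponent dominates the number of literals. *)
Lemma regres_tableau T z : letters z ->
  REGRES_SIZE (tableau_instance T z) <-> ~ exists al, tableau_sat T z al.
Proof.
move=> hz; rewrite -tableau_cnf_sat; split.
  case=> cs [k [/encode_instance_inj[<- _] [P [HP _]]]] [al Hal].
  exact: resolution_sound HP Hal.
move=> Hun; exists (tableau_cnf T z), (2 ^ size_exponent T (size z)); split=> //.
have [|P [HP Hreg Hsize]] := @resolution_complete (tableau_cnf T z).
  by move=> al Hal; apply: Hun; exists al.
exists P; do 2 split=> //; apply: leq_trans Hsize _.
by rewrite leq_pexp2l // size_tableau_cnf.
Qed.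

(** * Padding the input and assembling the reduction *)

Section Reduction.
Variables (M : TM) (c d : nat).

Definition input_prefix (x : seq bool) : seq bool :=
  flatten [seq [:: b; b] | b <- x] ++ [:: false; true].

Lemma pair_bits_prefix x y : pair_bits x y = input_prefix x ++ y.
Proof. by rewrite /pair_bits /input_prefix -catA. Qed.

Definition cert_bound (n : nat) : nat := c * n ^ c + c.

Definition input_bound (x : seq bool) : nat :=
  size (input_prefix x) + cert_bound (size x).

(** The exponent [j] grows by one per pass of [square_poly_computes]; [input_bound] counts the
    letters other than 4, the factor of such a pass. *)
Definition input_word (j : nat) (x : seq bool) : seq nat :=
  map nat_of_bool (input_prefix x) ++ nseq (cert_bound (size x)) 3 ++
  nseq ((2 * d + 2) * input_bound x ^ j) 4.

(** The letter 2 holds the place of the pairing separator until [expand_letter] turns it into the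
    bits 0, 1; doubling earlier would spoil the count of the bits of [x]. *)
Definition cert_word (j : nat) (x : seq bool) : seq nat :=
  map nat_of_bool x ++ 2 :: nseq (c * size x ^ j) 3.

Lemma letters_cert_word j x : letters (cert_word j x).
Proof.
rewrite /letters all_cat; apply/andP; split; first exact: letters_bits.
by rewrite /= all_nseq orbT.
Qed.

Lemma letters_input_word j x : letters (input_word j x).
Proof.
rewrite /letters !all_cat !all_nseq !orbT !andbT; exact: letters_bits.
Qed.

Lemma repeat_other (a : nat) k s : a \notin s ->
  flatten [seq (if b == a then nseq k b else [:: b]) | b <- s] = s.
Proof.
elim: s => //= b s IH; rewrite inE negb_or => /andP[ne hs].
by rewrite eq_sym (negbTE ne) IH.
Qed.

Lemma repeat_nseq (a : nat) k n :
  flatten [seq (if b == a then nseq k b else [:: b]) | b <- nseq n a] = nseq (n * k) a.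
Proof. by elim: n => //= n ->; rewrite eqxx mulSn nseqD. Qed.

Lemma notin_bits (a : nat) (x : seq bool) : 1 < a -> a \notin map nat_of_bool x.
Proof. by move=> ha; apply/mapP => -[b _ e]; rewrite e in ha; case: b ha {e}. Qed.

Lemma cert_word_poly j : poly_computes id (fun x => enc (cert_word j x)).
Proof.
elim: j => [|j IH].
  apply: poly_computes_trans load_poly_computes _.
  apply: poly_computes_ext
    (@subst_poly_computes _ _ (fun a => [:: a]) (2 :: nseq c 3) letters_bits) _.
  by move=> x; rewrite flatten_map1 /cert_word expn0 muln1.
apply: poly_computes_trans IH _.
apply: poly_computes_ext (square_poly_computes 3 (fun a => a < 2) (letters_cert_word j)) _.
move=> x; congr enc; rewrite /cert_word map_cat flatten_cat repeat_other ?notin_bits //=.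
rewrite repeat_nseq count_cat /= count_nseq /= add0n mul0n addn0 expnSr mulnA.
congr (_ ++ _ :: nseq (_ * _) _).
by rewrite count_map -[RHS](count_predT x); apply: eq_count => -[].
Qed.

Definition expand_letter (a : nat) : seq nat :=
  match a with 0 => [:: 0; 0] | 1 => [:: 1; 1] | 2 => [:: 0; 1] | _ => [:: 3] end.

Lemma input_word_poly j : poly_computes id (fun x => enc (input_word j x)).
Proof.
elim: j => [|j IH].
  apply: poly_computes_trans (cert_word_poly c) _.
  apply: poly_computes_ext (@subst_poly_computes _ _ expand_letter
    (nseq c 3 ++ nseq (2 * d + 2) 4) (letters_cert_word c)) _.
  move=> x; congr enc; rewrite /cert_word /input_word expn0 muln1.
  have E n : flatten (map expand_letter (2 :: nseq n 3)) = [:: 0; 1] ++ nseq n 3.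
    by rewrite /=; congr [:: _, _ & _]; elim: n => //= n ->.
  rewrite map_cat flatten_cat E /cert_bound (nseqD (c * _) c) /input_prefix map_cat -!catA.
  congr (_ ++ _); rewrite map_flatten; congr flatten; rewrite -!map_comp.
  by apply: eq_map => -[].
apply: poly_computes_trans IH _.
apply: poly_computes_ext (square_poly_computes 4 (fun a => a != 4) (letters_input_word j)) _.
move=> x; congr enc; rewrite /input_word.
have hc : count (fun a => a != 4) (map nat_of_bool (input_prefix x)) = size (input_prefix x).
  by rewrite count_map -[RHS](count_predT (input_prefix x)); apply: eq_count => -[].
have hn : 4 \notin map nat_of_bool (input_prefix x) by apply: notin_bits.
move: hc hn; move: (map nat_of_bool (input_prefix x)) => u hc hn.
rewrite !map_cat !flatten_cat repeat_nseq !repeat_other //; last by rewrite mem_nseq andbF.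
congr (_ ++ (_ ++ nseq _ _)); rewrite !count_cat hc !count_nseq /= mul1n mul0n addn0.
by rewrite expnSr mulnA.
Qed.

Hypothesis V_poly : forall x : seq bool, exists t : nat, t <= d * size x ^ d + d /\
  tm_halted (iter t (tm_step M) (tm_init M x)).

Lemma halted_conf w t :
  tm_halt (shift_tm M) (conf M w t.+1).1 = tm_halted (iter t (tm_step M) (tm_init M w)).
Proof. by rewrite conf_run; case: (iter t _ _) => [[[q l] a] r]. Qed.

(** From an assignment, row 0 yields [y], on which the verifier halts within the tableau and hence
    must accept; conversely an accepting run is itself a satisfying assignment. *)
Lemma tableau_certificate x :
  (exists al, tableau_sat (templates M) (input_word d x) al) <->
  (exists y t, [/\ size y <= cert_bound (size x),
     tm_halted (iter t (tm_step M) (tm_init M (pair_bits x y))) &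
     tm_output (iter t (tm_step M) (tm_init M (pair_bits x y))) = [:: true]]).
Proof.
set p := input_prefix x; set k := cert_bound (size x).
have p1 : 1 < size p by rewrite /p size_cat /=; lia.
have Ez : input_word d x = map nat_of_bool p ++ nseq k 3 ++
                           nseq ((2 * d + 2) * (size p + k) ^ d) 4 by [].
have Ep y : pair_bits x y = p ++ y by exact: pair_bits_prefix.
move: p1 Ez Ep; move: p k (input_word d x) => p k z p1 Ez Ep.
have sz : size z = size p + (k + (2 * d + 2) * (size p + k) ^ d).
  by rewrite Ez !size_cat size_map !size_nseq.
have zp i : i < size p -> nth 0 z i = nat_of_bool (nth false p i).
  by move=> hi; rewrite Ez nth_cat size_map hi (nth_map false).
have zc i : i < k -> nth 0 z (size p + i) = 3.
  move=> hi; rewrite Ez nth_cat size_map ltnNge leq_addr /= addKn.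
  by rewrite nth_cat size_nseq hi nth_nseq hi.
have zb i : size p + k <= i < size z -> nth 0 z i = 4.
  rewrite sz Ez => hi; rewrite nth_cat size_map; case: ltnP => h1; first by exfalso; lia.
  rewrite nth_cat size_nseq; case: ltnP => h2; first by exfalso; lia.
  by rewrite nth_nseq ifT //; lia.
split.
  case=> al Hsat.
  have [||y hy Hy] := tableau_sound (p := p) (k := k) _ _ zp zc zb Hsat.
  - by rewrite sz; lia.
  - by rewrite sz; lia.
  have [t [le_t hh]] := V_poly (p ++ y).
  (* With [N = size p + k], which is positive, [t.+1] is at most [(2 * d + 1) * N ^ d], below the
     number [(2 * d + 2) * N ^ d] of padding blanks. The extra step is the initial move of
     [shift_tm]. *)
  have lt_t : t.+1 < size z.
    have h1 : size (p ++ y) ^ d <= (size p + k) ^ d.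
      by apply: leq_exp_base; rewrite size_cat leq_add2l.
    have h2 : d * size (p ++ y) ^ d <= d * (size p + k) ^ d by rewrite leq_mul2l h1 orbT.
    have h3 : 0 < (size p + k) ^ d by rewrite expn_gt0; lia.
    by rewrite sz; nia.
  exists y, t; rewrite Ep.
  have /accepting_output[] : accepting (conf M (p ++ y) t.+1).
    by apply: Hy; rewrite ?halted_conf.
  by [].
case=> y [t [hy hh ho]].
rewrite Ep in hh ho.
exists (fact M (p ++ y)); apply: (@tableau_complete _ _ _ t.+1).
- move=> i b hi e.
  have hp : i < size p.
    case: (ltnP i (size p)) => // h1; case: (ltnP (i - size p) k) => h2.
      by have := zc _ h2; rewrite subnKC // e; case: b {e}.
    by have := zb i; rewrite e hi andbT => /(_ _); case: b {e} => h; exfalso; have := h _; lia.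
  rewrite map_cat nth_cat size_map hp (nth_map false) //.
  by move: e; rewrite zp //; case: b; case: (nth false p i).
- move=> i hi e; rewrite nth_default // size_map size_cat.
  case: (ltnP i (size p)) => h1; first by move: e; rewrite zp //; case: (nth false p i).
  case: (ltnP (i - size p) k) => h2; first by have := zc _ h2; rewrite subnKC // e.
  by lia.
- by apply/accepting_output.
Qed.

End Reduction.

Theorem theorem8 : coNP_hard REGRES_SIZE.
Proof.
move=> L [V [[M [d HM]] [c HL]]].
exists (fun x => tableau_instance (templates M) (input_word c d d x)); split.
  apply: poly_computes_time; apply: poly_computes_trans (input_word_poly c d d) _.
  by apply: tableau_instance_poly => x; apply: letters_input_word.
move=> x; rewrite regres_tableau; last exact: letters_input_word.
have VM w : exists t, t <= d * size w ^ d + d /\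
    tm_halted (iter t (tm_step M) (tm_init M w)).
  by have [t [? [? _]]] := HM w; exists t.
rewrite (tableau_certificate c VM).
have -> : L x <-> ~ ~ L x by split; [move=> h; apply | apply: NNPP].
suff -> : (~ L x) <-> exists y t, [/\ size y <= cert_bound c (size x),
     tm_halted (iter t (tm_step M) (tm_init M (pair_bits x y))) &
     tm_output (iter t (tm_step M) (tm_init M (pair_bits x y))) = [:: true]] by [].
rewrite HL; split=> [[y [hy hV]]|[y [t [hy hh ho]]]].
  by have [t [_ [hh ho]]] := HM (pair_bits x y); exists y, t; rewrite ho hV.
exists y; split=> //; have [t' [_ [hh' <-]]] := HM (pair_bits x y); rewrite -ho.
(* The given halting time [t] and the time [t'] at which the verifier delivers its value may differ;
   halted configurations are fixed, so the outputs agree. *)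
have stop (a b : nat) : a <= b -> tm_halted (iter a (tm_step M) (tm_init M (pair_bits x y))) ->
    iter b (tm_step M) (tm_init M (pair_bits x y)) =
    iter a (tm_step M) (tm_init M (pair_bits x y)).
  move=> /subnK <-; rewrite iterD; case: (iter a _ _) => [[[q l] s] r] /= hq.
  by elim: (b - a) => //= n ->; rewrite /= hq.
by case: (leqP t t') => [h|/ltnW h]; rewrite (stop _ _ h).
Qed.
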